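(* Let $G\subset Sp(2N)\subset \mathrm{End}(V)$, $V=\mathbb{C}^{2N}$, be a symplectic reflection group and let $H_{1,\eta}(G)$ be the associated symplectic reflection algebra, with its natural parity. Let $T_G$ be the number of conjugacy classes of $G$ consisting of elements without eigenvalue $1$, and let $S_G$ be the number of conjugacy classes of $G$ consisting of elements without eigenvalue $-1$. Then $H_{1,\eta}(G)$ possesses $T_G$ independent traces and $S_G$ independent supertraces; that is, the vector space of traces on $H_{1,\eta}(G)$ has dimension $T_G$ and the vector space of supertraces on $H_{1,\eta}(G)$ has dimension $S_G$.
   Context: Let $V=\mathbb{C}^{2N}$ carry a non-degenerate antisymmetric bilinear form $\omega$, and let $Sp(2N)\subset \mathrm{End}(V)$ be the group of linear maps preserving $\omega$. An element $R\in Sp(2N)$ is a symplectic reflection if $\mathrm{rk}(R-1)=2$. A symplectic reflection group is a finite subgroup $G\subset Sp(2N)$ generated by a set of symplectic reflections; $\mathcal{R}$ denotes the set of all symplectic reflections in $G$. For $R\in\mathcal{R}$ put $V_R=\mathrm{Im}(R-1)$, $Z_R=\mathrm{Ker}(R-1)$; then $V=V_R\oplus Z_R$ is an $\omega$-orthogonal decomposition, and $\omega_R(x,y):=\omega(x_{V_R},y_{V_R})$, where $x_{V_R}$ denotes the component of $x$ in $V_R$. Let $\eta:\mathcal{R}\to\mathbb{C}$, $R\mapsto\eta_R$, be constant on $G$-conjugacy classes. The symplectic reflection algebra $H_{1,\eta}(G)$ is the unital associative complex algebra generated by $V$ and the group algebra $\mathbb{C}[G]$ subject to the relations $gx=g(x)g$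 for $g\in G$, $x\in V$, and $[x,y]=xy-yx=\omega(x,y)+\sum_{R\in\mathcal{R}}\eta_R\,\omega_R(x,y)R$ for $x,y\in V$. It is a superalgebra with parity $\pi(x)=1$ for $x\in V$ and $\pi(g)=0$ for $g\in G$. A trace on an associative superalgebra $\mathcal{A}$ is a linear function $tr$ with $tr(fg)=tr(gf)$ for all $f,g\in\mathcal{A}$; a supertrace is a linear function $str$ with $str(fg)=(-1)^{\pi(f)\pi(g)}str(gf)$ for all homogeneous $f,g\in\mathcal{A}$. *)

(* Defs.v *)
From HB Require Import structures.
From mathcomp Require Import all_boot all_order all_fingroup all_algebra.
From mathcomp Require Import sesquilinear.
From mathcomp Require Import boolp functions reals complex monalg.

Set Implicit Arguments.
Unset Strict Implicit.
Unset Printing Implicit Defensive.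

Import GRing.Theory.

Local Open Scope ring_scope.
Local Open Scope quotient_scope.

(* The unital associative K-algebra generated by X subject to the relations
   f = 0 for rel f: the free algebra on X, i.e. the monoid algebra of the free
   monoid on X, modulo the two-sided ideal generated by rel.  The result is
   given as a possibly trivial ring which is also a K-module (algType would
   require a proof of 1 != 0). *)
Section PresentedAlgebra.
Variables (K : fieldType) (X : choiceType).

Local Notation free_alg := {malg K[{fmonom X}]}.

Definition free_gen (i : X) : free_alg := << fmu i >>.

Variable rel : free_alg -> Prop.

Inductive rel_ideal_spec : free_alg -> Prop :=
| RelIdealGen f : rel f -> rel_ideal_spec f
| RelIdeal0 : rel_ideal_spec 0
| RelIdealB f g :
    rel_ideal_spec f -> rel_ideal_spec g -> rel_ideal_spec (f - g)
| RelIdealMl f g : rel_ideal_spec g -> rel_ideal_spec (f * g)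
| RelIdealMr f g : rel_ideal_spec f -> rel_ideal_spec (f * g).

Definition rel_ideal : {pred free_alg} := [pred f | `[< rel_ideal_spec f >]].

Lemma rel_idealP f : reflect (rel_ideal_spec f) (f \in rel_ideal).
Proof. exact: asboolP. Qed.

Lemma rel_ideal_zmod_closed : zmod_closed rel_ideal.
Proof.
split=> [|f g /rel_idealP If /rel_idealP Ig]; apply/rel_idealP.
  exact: RelIdeal0.
exact: RelIdealB.
Qed.
HB.instance Definition _ :=
  GRing.isZmodClosed.Build free_alg rel_ideal rel_ideal_zmod_closed.

Definition pres_alg := Quotient.quot rel_ideal.
HB.instance Definition _ := GRing.Zmodule.on pres_alg.

Definition pres_pi (f : free_alg) : pres_alg := \pi_(Quotient.quot rel_ideal) f.

Lemma pres_piE f g : pres_pi f = pres_pi g <-> f - g \in rel_ideal.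
Proof.
by rewrite Quotient.idealrBE; split=> [H|/eqP H//]; apply/eqP.
Qed.

Lemma pres_pi_is_zmod_morphism : zmod_morphism pres_pi.
Proof. by move=> f g; rewrite /pres_pi !piE. Qed.
HB.instance Definition _ :=
  GRing.isZmodMorphism.Build free_alg pres_alg pres_pi pres_pi_is_zmod_morphism.

Definition pres_repr (a : pres_alg) : free_alg := generic_quotient.repr a.

Lemma pres_reprK : cancel pres_repr pres_pi.
Proof. by move=> a; exact: reprK. Qed.

Definition pres_one : pres_alg := pres_pi 1.
Definition pres_mul (a b : pres_alg) : pres_alg :=
  pres_pi (pres_repr a * pres_repr b).
Definition pres_scale (c : K) (a : pres_alg) : pres_alg :=
  pres_pi (c *: pres_repr a).

Lemma pres_repr_pi f : pres_repr (pres_pi f) - f \in rel_ideal.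
Proof. by apply/pres_piE; rewrite pres_reprK. Qed.

Lemma pres_pi_mul f g : pres_pi (f * g) = pres_mul (pres_pi f) (pres_pi g).
Proof.
apply/esym/pres_piE; set f' := pres_repr _; set g' := pres_repr _.
have -> : f' * g' - f * g = (f' - f) * g' + f * (g' - g).
  by rewrite mulrBl mulrBr addrA subrK.
by apply: rpredD; apply/rel_idealP;
   [apply: RelIdealMr | apply: RelIdealMl]; apply/rel_idealP/pres_repr_pi.
Qed.

Lemma pres_pi_scale c f : pres_pi (c *: f) = pres_scale c (pres_pi f).
Proof.
apply/esym/pres_piE; rewrite -scalerBr -mul_malgC.
by apply/rel_idealP/RelIdealMl/rel_idealP/pres_repr_pi.
Qed.

Lemma pres_mulA : associative pres_mul.
Proof.
move=> a b c; rewrite -(pres_reprK a) -(pres_reprK b) -(pres_reprK c).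
by rewrite -!pres_pi_mul mulrA.
Qed.

Lemma pres_mul1 : left_id pres_one pres_mul.
Proof. by move=> a; rewrite -(pres_reprK a) -pres_pi_mul mul1r. Qed.

Lemma pres_mulr1 : right_id pres_one pres_mul.
Proof. by move=> a; rewrite -(pres_reprK a) -pres_pi_mul mulr1. Qed.

Lemma pres_mulDl : left_distributive pres_mul +%R.
Proof.
move=> a b c; rewrite -(pres_reprK a) -(pres_reprK b) -(pres_reprK c).
by rewrite -raddfD -!pres_pi_mul mulrDl raddfD.
Qed.

Lemma pres_mulDr : right_distributive pres_mul +%R.
Proof.
move=> a b c; rewrite -(pres_reprK a) -(pres_reprK b) -(pres_reprK c).
by rewrite -raddfD -!pres_pi_mul mulrDr raddfD.
Qed.

HB.instance Definition _ := GRing.Zmodule_isPzRing.Build pres_alg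
  pres_mulA pres_mul1 pres_mulr1 pres_mulDl pres_mulDr.

Lemma pres_scaleA c d a : pres_scale c (pres_scale d a) = pres_scale (c * d) a.
Proof. by rewrite -(pres_reprK a) -!pres_pi_scale scalerA. Qed.

Lemma pres_scale1 : left_id 1 pres_scale.
Proof. by move=> a; rewrite -(pres_reprK a) -pres_pi_scale scale1r. Qed.

Lemma pres_scaleDr : right_distributive pres_scale +%R.
Proof.
move=> c a b; rewrite -(pres_reprK a) -(pres_reprK b).
by rewrite -raddfD -!pres_pi_scale scalerDr raddfD.
Qed.

Lemma pres_scaleDl a : {morph pres_scale^~ a : c d / c + d}.
Proof.
by move=> c d; rewrite -(pres_reprK a) -!pres_pi_scale scalerDl raddfD.
Qed.

HB.instance Definition _ := GRing.Zmodule_isLmodule.Build K pres_alg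
  pres_scaleA pres_scale1 pres_scaleDr pres_scaleDl.

Definition pres_gen (i : X) : pres_alg := pres_pi (free_gen i).

End PresentedAlgebra.

(* A finite subgroup of Sp(V, omega) is given as a finite group G together with
   an embedding rho : G -> End(V) whose image preserves omega. *)
Section SymplecticReflections.
Variables (K : fieldType) (V : vectType K) (omega : {skew_symmetric V}).
Variables (G : finGroupType) (rho : G -> 'End(V)).

Definition sp_subgroup : Prop :=
  [/\ injective rho, rho 1%g = \1%VF,
      forall g h, rho (g * h)%g = (rho g \o rho h)%VF
    & forall g x y, omega (rho g x) (rho g y) = omega x y].

Definition sp_reflections : {set G} :=
  [set g | \dim (limg (rho g - \1)%VF) == 2].

Definition sp_reflection_group : Prop :=
  sp_subgroup /\
  exists2 S : {set G}, S \subset sp_reflections & <<S>>%g = [set: G].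

(* omega (x_{V_R}, y_{V_R}), where x_{V_R} is the projection of x to
   V_R = Im (R - 1) along Z_R = Ker (R - 1). *)
Definition omega_refl (r : G) (x y : V) : K :=
  let pr := daddv_pi (limg (rho r - \1)%VF) (lker (rho r - \1)%VF) in
  omega (pr x) (pr y).

Definition classes_without_eigenvalue (a : K) : {set {set G}} :=
  [set c in classes [set: G] | [forall g in c, ~~ passmx.leigenvalue (rho g) a]].

End SymplecticReflections.

Section SymplecticReflectionAlgebra.
Variables (K : fieldType) (V : vectType K) (omega : {skew_symmetric V}).
Variables (G : finGroupType) (rho : G -> 'End(V)) (eta : G -> K).

Local Notation X := (V + G)%type.
Local Notation vec x := (@free_gen K X (inl x)).
Local Notation grp g := (@free_gen K X (inr g)).

(* The first two families make x |-> vec x linear and g |-> grp g extend to a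
   morphism from the group algebra. *)
Inductive sra_rel : {malg K[{fmonom X}]} -> Prop :=
| SraLin a x y : sra_rel (vec (a *: x + y) - (a *: vec x + vec y))
| SraGrp1 : sra_rel (grp 1%g - 1)
| SraGrpM g h : sra_rel (grp (g * h)%g - grp g * grp h)
| SraCross g x : sra_rel (grp g * vec x - vec (rho g x) * grp g)
| SraComm x y :
    sra_rel (vec x * vec y - vec y * vec x
      - ((omega x y)%:A
         + \sum_(r in sp_reflections rho)
             (eta r * omega_refl omega rho r x y) *: grp r)).

Local Notation sra := (pres_alg sra_rel).

Definition sra_vec (x : V) : sra := pres_gen sra_rel (inl x).
Definition sra_grp (g : G) : sra := pres_gen sra_rel (inr g).

(* sra_homog p f: f is homogeneous of parity p. *)
Inductive sra_homog : bool -> sra -> Prop :=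
| SraHomogVec x : sra_homog true (sra_vec x)
| SraHomogGrp g : sra_homog false (sra_grp g)
| SraHomog0 p : sra_homog p 0
| SraHomogD p f g : sra_homog p f -> sra_homog p g -> sra_homog p (f + g)
| SraHomogZ p a f : sra_homog p f -> sra_homog p (a *: f)
| SraHomogM p q f g :
    sra_homog p f -> sra_homog q g -> sra_homog (p (+) q) (f * g).

Definition is_trace (t : sra -> K^o) : Prop :=
  linear t /\ forall f g, t (f * g) = t (g * f).

Definition is_supertrace (t : sra -> K^o) : Prop :=
  linear t /\ forall p q f g, sra_homog p f -> sra_homog q g ->
    t (f * g) = (-1) ^+ (p && q) * t (g * f).

End SymplecticReflectionAlgebra.

Arguments is_trace {K V} omega {G} rho eta t.
Arguments is_supertrace {K V} omega {G} rho eta t.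

(* W is a subspace of E of dimension d: it is the span of d linearly
   independent vectors.  (E need not be finite-dimensional.) *)
Definition has_dim (K : fieldType) (E : lmodType K) (W : E -> Prop) (d : nat) :=
  exists b : 'I_d -> E,
    (forall c : 'I_d -> K, \sum_i c i *: b i = 0 -> forall i, c i = 0) /\
    (forall e, W e <-> exists c : 'I_d -> K, e = \sum_i c i *: b i).

(* Main.v *)
(* A linear functional t on H is recorded by the multilinear functions
   T g (x1 .. xn) = t (x1 * .. * xn * g); the commutation relations are the only
   constraint on T.  By the Jacobi identity every symmetric top degree part
   extends (PBW), the correction being built one letter position at a time.

   Traces (kappa = 1) and supertraces (kappa = -1) are the t with
   t (x a) = kappa t (a x) for x in V and t (g a) = t (a g) for g in G: both
   sides of the first equation vanish, for a supertrace, when a is even.  Let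
   d g be the dimension of Ker (kappa g - 1).  For x in Im (1 - kappa g) the
   equation at a word w g expresses the part of T g of degree |w| + 1 through
   lower ones.  For x in Ker (kappa g - 1) it reads t ([x, w] g) = 0, where
   [x, w] is the derivation of w along omega x plus terms containing reflections
   R; these contribute words times R g, and d (R g) < d g because the common
   fixed space of kappa g and R is symplectic, hence of codimension at least 2
   in Ker (kappa g - 1).  Euler's identity then recovers T g in degree |w| - 1,
   except in degree 0 when d g = 0.  So the values of t on the g without
   eigenvalue kappa determine t; as twisted commutators in different directions
   commute, the same recursion constructs t from any class function on these g. *)

Require Import Defs.
From HB Require Import structures.
From mathcomp Require Import all_boot all_order all_fingroup all_algebra.
From mathcomp Require Import sesquilinear.
From mathcomp Require Import boolp functions reals complex.
From mathcomp Require Import monalg cyclic ring zify.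

Set Implicit Arguments.
Unset Strict Implicit.
Unset Printing Implicit Defensive.

Import GRing.Theory Num.Theory.

Local Open Scope ring_scope.

(** The obstacle to existence is that the degree n part of T g is constrained twice: by the
    equations in Im (1 - kappa g) at words of length n - 1, and by those in the fixed directions at
    words of length n + 1, which also see T (R g). Such a system is solvable only under a closedness
    condition, and it is the same each time: if t is invariant under conjugation, t (yxa - kappa xay
    - kappa yax + axy) is symmetric in x and y, because [x, y] lies in the group algebra. In Im (1 -
    kappa g) this makes the candidate symmetric; in the fixed directions it says that a 1-form with
    polynomial coefficients is closed, and Euler's identity supplies a primitive. Closedness in
    degree n can be read off only from T extended to degree n + 2, so each step begins with a
    tentative extension. The PBW correction is a Koszul homotopy of the same kind, with the Jacobi
    identity as closedness. The divisions are by Euler degrees and by orders of groups. *)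

(** An argument keeps its value from the stage of its size on, so the diagonal function agrees with
    one single stage on all arguments up to any given size. Properties that involve bounded sizes at
    a time therefore pass to the limit. *)
Lemma stable_limit (A B : Type) (sz : A -> nat) (P : nat -> (A -> B) -> Prop)
    (n : nat) (T : A -> B) :
  (forall m T, P m T ->
    exists2 T', P m.+1 T' & forall a, (sz a <= m)%N -> T' a = T a) ->
  P n T ->
  exists2 T', forall a, (sz a <= n)%N -> T' a = T a &
    forall m, (n <= m)%N ->
      exists2 Tm, P m Tm & forall a, (sz a <= m)%N -> T' a = Tm a.
Proof.
move=> step PT.
(* Made total for [choice]: where [P] fails, the successor is irrelevant. *)
have {}step (p : nat * (A -> B)) : exists T', P p.1 p.2 ->
    P p.1.+1 T' /\ forall a, (sz a <= p.1)%N -> T' a = p.2 a.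
  have [/step[T' ? ?]|nP] := pselect (P p.1 p.2); first by exists T'.
  by exists T.
have [next nextP] := choice step.
pose Ts := fix Ts m := if m is m'.+1 then next ((n + m')%N, Ts m') else T.
have TsS m : Ts m.+1 = next ((n + m)%N, Ts m) by [].
have PTs m : P (n + m)%N (Ts m).
  by elim: m => [|m /(nextP (_, _))[]]; rewrite ?addn0 ?addnS.
have TsE a m k : (sz a <= n + m)%N -> Ts (m + k)%N a = Ts m a.
  move=> sza; elim: k => [|k <-]; first by rewrite addn0.
  have [_ H] := nextP (_, _) (PTs (m + k)%N).
  by rewrite addnS TsS H //= (leq_trans sza) // addnA leq_addr.
exists (fun a => Ts (sz a - n)%N a) => [a|m nm].
  by rewrite -subn_eq0 => /eqP->.
exists (Ts (m - n)%N); first by rewrite -{1}(subnKC nm).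
move=> a sza; rewrite -(subnKC (leq_sub2r n sza)) TsE //.
by rewrite -leq_subLR.
Qed.

(** * Multilinear functions on words *)

Section Multilinear.
Variables (K : fieldType) (V : lmodType K).
Implicit Types (f : seq V -> K) (s u v w : seq V) (x y z : V).

Definition multilinear f := forall u v a x y,
  f (u ++ (a *: x + y) :: v) = a * f (u ++ x :: v) + f (u ++ y :: v).

Definition symmetric_at n f := forall u v x y,
  size (u ++ x :: y :: v) = n -> f (u ++ x :: y :: v) = f (u ++ y :: x :: v).

Lemma multilinear0 f u v : multilinear f -> f (u ++ 0 :: v) = 0.
Proof.
move=> fM; have := fM u v (-1) 0 0; rewrite scaler0 addr0 mulN1r addNr.
exact.
Qed.

Lemma multilinearD f u v x y : multilinear f ->
  f (u ++ (x + y) :: v) = f (u ++ x :: v) + f (u ++ y :: v).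
Proof. by move=> fM; rewrite -[x in LHS]scale1r fM mul1r. Qed.

Lemma multilinearZ f u v a x : multilinear f ->
  f (u ++ (a *: x) :: v) = a * f (u ++ x :: v).
Proof. by move=> fM; rewrite -[_ *: _]addr0 fM multilinear0 // addr0. Qed.

Lemma multilinearB f u v x y : multilinear f ->
  f (u ++ (x - y) :: v) = f (u ++ x :: v) - f (u ++ y :: v).
Proof.
by move=> fM; rewrite multilinearD // -scaleN1r multilinearZ // mulN1r.
Qed.

Lemma multilinear_sum f u v (I : finType) (c : I -> K) (X : I -> V) :
  multilinear f ->
  f (u ++ (\sum_i c i *: X i) :: v) = \sum_i c i * f (u ++ X i :: v).
Proof.
move=> fM; elim/big_rec2: _ => [|i _ y _ <-]; first exact: multilinear0.
exact: fM.
Qed.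

Lemma symmetric_front n f u v x : symmetric_at n f -> size (u ++ x :: v) = n ->
  f (u ++ x :: v) = f (x :: u ++ v).
Proof.
move=> fS; elim/last_ind: u v => [//|u y IH] v sz.
by rewrite !cat_rcons fS -?IH ?size_cat -?cat_rcons -?sz ?size_cat ?size_rcons
  //= !addnS.
Qed.

(* [picksum k f w [:: x1; ..; xn]] is the sum over i of
   [f xi (w ++ [:: k x1; ..; k x(i-1); x(i+1); ..; xn])]. *)
Fixpoint picksum (k : V -> V) (f : V -> seq V -> K) w v :=
  if v is y :: v' then f y (w ++ v') + picksum k f (rcons w (k y)) v' else 0.

Implicit Types (k : V -> V) (phi : V -> seq V -> K).

Lemma picksum_multilinear_l k phi v1 v :
  (forall y, multilinear (phi y)) ->
  multilinear (fun w => picksum k phi (v1 ++ w) v).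
Proof.
move=> fM u u' a x y; elim: v u' => [|z v IH] u' /=; first by rewrite mulr0 addr0.
rewrite -!(catA _ _ v) !cat_cons !(catA v1) fM mulrDr addrACA; congr (_ + _).
by rewrite -!catA !rcons_cat -IH.
Qed.

Lemma picksum0l k phi w v : (forall y, multilinear (phi y)) ->
  picksum k phi (0 :: w) v = 0.
Proof.
by move=> fM; apply: (multilinear0 [::] w (@picksum_multilinear_l k phi [::] v fM)).
Qed.

Lemma picksum_multilinear k phi w :
  (forall s a x y, phi (a *: x + y) s = a * phi x s + phi y s) ->
  (forall y, multilinear (phi y)) -> linear k -> multilinear (picksum k phi w).
Proof.
move=> fL fM kL u v a x y; elim: u w => [|z u IH] w /=; last first.
  by rewrite catA fM -!catA IH mulrDr addrACA.
rewrite fL kL mulrDr addrACA; congr (_ + _).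
have := @picksum_multilinear_l k phi w v fM [::] [::] a (k x) (k y).
by rewrite /= !cats1.
Qed.

Lemma picksum_symmetric_l n k phi v : (forall y, symmetric_at n (phi y)) ->
  symmetric_at (n.+1 - size v) (fun w => picksum k phi w v).
Proof.
move=> fS u u' x y; elim: v u' => [//|z v IH] u' sz /=.
rewrite -!catA !cat_cons fS; last first.
  by move: sz; rewrite !size_cat /= size_cat /=; lia.
by rewrite !rcons_cat /= IH // size_cat /= size_rcons; move: sz; rewrite size_cat /=; lia.
Qed.

(** Under a swap of adjacent letters x, y, picking an earlier letter leaves the swap inside the
    symmetric [phi], picking a later one leaves it in the prefix, and the two summands that pick x
    or y are compared by the third hypothesis. *)
Lemma picksum_symmetric n m k phi w :
  (forall y, symmetric_at n (phi y)) -> (size w + m = n)%N ->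
  (forall x y u v, size (u ++ x :: v) = n ->
     phi x (u ++ y :: v) + phi y (u ++ k x :: v) =
     phi y (u ++ x :: v) + phi x (u ++ k y :: v)) ->
  symmetric_at m.+1 (picksum k phi w).
Proof.
move=> fS szw fk u v x y; elim: u w m szw => [|z u IH] w m szw /= [sz].
  rewrite !cat_rcons !addrA; congr (_ + _).
    by apply: fk; rewrite size_cat /= sz.
  rewrite -!cats1 -!catA /=.
  by apply: (@picksum_symmetric_l n k phi v fS w [::]); rewrite size_cat /=; lia.
congr (_ + _); first by rewrite !catA fS // -catA size_cat sz.
case: m szw sz => [|m] szw sz; first by move: sz; rewrite size_cat /=; lia.
by apply: (IH _ m) => //; rewrite size_rcons addSn -addnS.
Qed.

Lemma picksum_prefix k phi u w v :
  picksum k phi (u ++ w) v = picksum k (fun x s => phi x (u ++ s)) w v.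
Proof.
by elim: v w => [//|y v IH] w /=; rewrite -catA rcons_cat IH.
Qed.

Lemma eq_picksum n k phi phi' w v :
  (forall x s, size s = n -> phi x s = phi' x s) -> (size w + size v = n.+1)%N ->
  picksum k phi w v = picksum k phi' w v.
Proof.
move=> eqf; elim: v w => [//|y v IH] w /= sz; rewrite eqf ?size_cat; last by lia.
by congr (_ + _); apply: IH; rewrite size_rcons; lia.
Qed.

Lemma picksum_sum (I : finType) (c : I -> K) (phi : I -> V -> seq V -> K) k w v :
  picksum k (fun x s => \sum_i c i * phi i x s) w v
  = \sum_i c i * picksum k (phi i) w v.
Proof.
elim: v w => [|y v IH] w /=; first by rewrite big1 // => i _; rewrite mulr0.
by rewrite IH -big_split /=; apply: eq_bigr => i _; rewrite mulrDr.
Qed.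

Lemma picksum_self n (f : seq V -> K) w v : symmetric_at n f ->
  (size w + size v = n)%N ->
  picksum id (fun x s => f (x :: s)) w v = (size v)%:R * f (w ++ v).
Proof.
move=> fS; elim: v w => [|y v IH] w /= sz; first by rewrite mul0r.
rewrite IH; last by rewrite size_rcons; lia.
by rewrite cat_rcons (symmetric_front fS) ?size_cat // -[in RHS]natr1 mulrDl mul1r addrC.
Qed.

Lemma picksum0 k w v : picksum k (fun _ _ => 0) w v = 0.
Proof. by elim: v w => [|y v IH] w //=; rewrite IH addr0. Qed.

Lemma picksum_linear k (phi phi1 phi2 : V -> seq V -> K) a w v :
  (forall y s, phi y s = a * phi1 y s + phi2 y s) ->
  picksum k phi w v = a * picksum k phi1 w v + picksum k phi2 w v.
Proof.
move=> E; elim: v w => [|y v IH] w /=; first by rewrite mulr0 addr0.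
by rewrite IH E; ring.
Qed.

End Multilinear.

(** * The PBW property *)

Section Straightening.
Variables (K : fieldType) (V : lmodType K) (G : finGroupType).
Variables (act : G -> V -> V) (b : G -> V -> V -> K).
Hypothesis charK : forall n, n.+1%:R != 0 :> K.
Hypothesis actL : forall g, linear (act g).
Hypothesis actM : forall g h x, act (g * h)%g x = act g (act h x).
Hypothesis bL : forall g a x y z, b g (a *: x + y) z = a * b g x z + b g y z.
Hypothesis bC : forall g x y, b g x y = - b g y x.
Hypothesis bJ : forall g h x y, b (g ^ h^-1)%g (act h x) (act h y) = b g x y.
Hypothesis bjacobi : forall g x y z,
  b g x y *: (act g z - z) + b g y z *: (act g x - x)
  + b g z x *: (act g y - y) = 0.
Implicit Types (T : G -> seq V -> K) (s u v w : seq V) (x y z : V) (g h : G).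

Lemma act0 g : act g 0 = 0.
Proof. by have := actL g (-1) 0 0; rewrite scaler0 addr0 scaleN1r addNr. Qed.

(** Each summand is t (u r v g) in normal form: r is carried to the right through v, acts on its
    letters and joins g. *)
Definition bracket_term T g u x y v :=
  \sum_r b r x y * T (r * g)%g (u ++ map (act r) v).

Definition defect T g u x y v :=
  T g (u ++ x :: y :: v) - T g (u ++ y :: x :: v) - bracket_term T g u x y v.

(** Only positions from [j] on are tested, so that corrections can proceed from the end of a word to
    its beginning. *)
Definition straight_at n j T := forall g u x y v,
  size (u ++ x :: y :: v) = n -> (j <= size u)%N -> defect T g u x y v = 0.

Definition straight n T := forall m, (m <= n)%N -> straight_at m 0 T.

Definition multilinears T := forall g, multilinear (T g).

Lemma bracket_termC T g u x y v :
  bracket_term T g u y x v = - bracket_term T g u x y v.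
Proof. by rewrite -sumrN; apply: eq_bigr => r _; rewrite bC mulNr. Qed.

Lemma defectC T g u x y v : defect T g u y x v = - defect T g u x y v.
Proof. by rewrite /defect bracket_termC; ring. Qed.

Lemma bracket_term_multilinear_r T g u x y : multilinears T ->
  multilinear (bracket_term T g u x y).
Proof.
move=> TM v v' a z t; rewrite mulr_sumr -big_split /=; apply: eq_bigr => r _.
by rewrite !map_cat /= actL !(catA u) TM; ring.
Qed.

Lemma bracket_term_multilinear_l T g x y v : multilinears T ->
  multilinear (fun u => bracket_term T g u x y v).
Proof.
move=> TM u u' a z t; rewrite mulr_sumr -big_split /=; apply: eq_bigr => r _.
by rewrite -!catA /= TM; ring.
Qed.

Lemma bracket_term_linear T g u a x x' y v :
  bracket_term T g u (a *: x + x') y v =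
  a * bracket_term T g u x y v + bracket_term T g u x' y v.
Proof.
rewrite mulr_sumr -big_split /=; apply: eq_bigr => r _.
by rewrite bL; ring.
Qed.

Lemma defect_multilinear_r T g u x y : multilinears T ->
  multilinear (defect T g u x y).
Proof.
move=> TM v v' a z t; rewrite /defect bracket_term_multilinear_r //.
have E p q : T g (u ++ p :: q :: v ++ (a *: z + t) :: v') =
   a * T g (u ++ p :: q :: v ++ z :: v') + T g (u ++ p :: q :: v ++ t :: v').
  by have := TM g (u ++ p :: q :: v) v' a z t; rewrite -!catA.
by rewrite !E; ring.
Qed.

Lemma defect_multilinear_l T g x y v : multilinears T ->
  multilinear (fun u => defect T g u x y v).
Proof.
move=> TM u u' a z t; rewrite /defect bracket_term_multilinear_l //.
by rewrite -!catA /= !TM; ring.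
Qed.

Lemma defect_linear T g u a x x' y v : multilinears T ->
  defect T g u (a *: x + x') y v = a * defect T g u x y v + defect T g u x' y v.
Proof.
move=> TM; rewrite /defect bracket_term_linear TM.
have := TM g (rcons u y) v a x x'; rewrite !cat_rcons => ->; ring.
Qed.

Lemma defect_linear_r T g u a x x' y v : multilinears T ->
  defect T g u y (a *: x + x') v = a * defect T g u y x v + defect T g u y x' v.
Proof. by move=> TM; rewrite defectC defect_linear // opprD -mulrN -!defectC. Qed.

(* Going around the hexagon of the six orderings of x, y, z, the bracket terms
   cancel by the Jacobi identity. *)
Lemma defect_hexagon T g u x y z v : multilinears T ->
  defect T g u x y (z :: v) + defect T g (rcons u y) x z v + defect T g u y z (x :: v)
  = defect T g (rcons u x) y z v + defect T g u x z (y :: v)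
    + defect T g (rcons u z) x y v.
Proof.
move=> TM; apply/eqP; rewrite -subr_eq0 /defect !cat_rcons.
pose C r x y z := b r x y * T (r * g)%g (u ++ (act r z - z) :: map (act r) v).
have E p q t : bracket_term T g u p q (t :: v) - bracket_term T g (rcons u t) p q v
    = \sum_r C r p q t.
  rewrite -sumrB; apply: eq_bigr => r _.
  by rewrite /C (multilinearB _ _ _ _ (TM _)) cat_rcons mulrBr.
have Ez : \sum_r C r x y z + \sum_r C r y z x + \sum_r C r z x y = 0.
  rewrite -!big_split big1 //= => r _; rewrite /C.
  rewrite -!(multilinearZ _ _ _ _ (TM _)) -!(multilinearD _ _ _ _ (TM _)).
  by rewrite bjacobi multilinear0.
have Ec : \sum_r C r z x y = - \sum_r C r x z y.
  by rewrite -sumrN; apply: eq_bigr => r _; rewrite /C bC mulNr.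
move: Ez; rewrite Ec -!E => Ez.
apply/eqP; rewrite -[RHS]oppr0 -[in RHS]Ez; ring.
Qed.

Lemma straightE n j T g u x y v : straight_at n j T ->
  size (u ++ x :: y :: v) = n -> (j <= size u)%N ->
  T g (u ++ x :: y :: v) = T g (u ++ y :: x :: v) + bracket_term T g u x y v.
Proof. by move=> Tn sz szu; rewrite -[LHS]subr0 -(Tn g _ _ _ _ sz szu) /defect; ring. Qed.

(** Relations at disjoint positions commute. Swapping p and q in v changes the two leading words by
    brackets at a later position and the bracket term by a bracket in lower degree; both changes are
    the same double sum over r and s. *)
Lemma defect_symmetric n j T g u x y : straight n T ->
  straight_at n.+1 j.+1 T -> (j <= size u)%N ->
  symmetric_at (n.+1 - (size u).+2) (defect T g u x y).
Proof.
move=> Tn Tj szu v1 v2 p q sz.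
have szE : (size u + (size v1 + size v2)).+4 = n.+1.
  by move: sz; rewrite size_cat /=; lia.
apply/eqP; rewrite -subr_eq0 /defect.
have E c d : T g (u ++ c :: d :: v1 ++ p :: q :: v2)
    = T g (u ++ c :: d :: v1 ++ q :: p :: v2)
      + bracket_term T g (u ++ c :: d :: v1) p q v2.
  have := @straightE n.+1 j.+1 T g (u ++ c :: d :: v1) p q v2 Tj.
  by rewrite -!catA; apply; rewrite !size_cat /= ?size_cat /=; lia.
rewrite !E.
have Ecomm : bracket_term T g u x y (v1 ++ p :: q :: v2)
   - bracket_term T g u x y (v1 ++ q :: p :: v2) =
   bracket_term T g (u ++ x :: y :: v1) p q v2 -
   bracket_term T g (u ++ y :: x :: v1) p q v2.
  rewrite -!sumrB.
  transitivity (\sum_r \sum_s b r x y * (b s p q *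
       T (r * s * g)%g (u ++ map (act r) v1 ++ map (act (r * s)%g) v2))).
    apply: eq_bigr => r _; rewrite -mulrBr -mulr_sumr; congr (_ * _).
    rewrite !map_cat /= !(catA u) (@straightE n.-1 0 T); first last.
    - by [].
    - by rewrite !size_cat /= !size_map; lia.
    - by apply: Tn; lia.
    (* Replacing s by $r s r^{-1}$ turns s r into r s and, by [bJ], removes r from the arguments of
       the form. *)
    rewrite addrC addKr /bracket_term (reindex_inj (conjg_inj r^-1%g)) /=.
    apply: eq_bigr => s _; rewrite bJ -map_comp -catA conjgE invgK !mulgA mulgKV.
    congr (_ * T _ (_ ++ _ ++ _)); apply: eq_map => z /=.
    by rewrite -actM mulgKV.
  rewrite exchange_big /=; apply: eq_bigr => s _.
  rewrite -mulrBr -!catA !cat_cons (@straightE n.-1 0 T _ u x); first last.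
  - by [].
  - by rewrite !size_cat /= size_cat !size_map; lia.
  - by apply: Tn; lia.
  rewrite addrC addKr /bracket_term mulr_sumr; apply: eq_bigr => r _.
  rewrite mulrCA mulgA map_cat -map_comp; congr (_ * (_ * T _ (_ ++ _ ++ _))).
  by apply: eq_map => z /=; rewrite actM.
apply/eqP; move: Ecomm => /eqP; rewrite -subr_eq0 => /eqP Ecomm.
by rewrite -[RHS]oppr0 -[in RHS]Ecomm; ring.
Qed.

Lemma eq_bracket_term n T T' g u x y v :
  (forall h s, (size s <= n)%N -> T' h s = T h s) -> (size u + size v <= n)%N ->
  bracket_term T' g u x y v = bracket_term T g u x y v.
Proof.
move=> eqT sz; apply: eq_bigr => r _.
by rewrite eqT // size_cat size_map.
Qed.

(* Added to T in degree n, this straightens position j if the positions after j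
   are straight already. *)
Definition correction n j T g s :=
  if size s != n then 0 else
  if drop j s is x :: v then
    - (size v).+1%:R^-1 * picksum id (defect T g (take j s) x) [::] v
  else 0.

Lemma correctionE n T g u x v : size (u ++ x :: v) = n ->
  correction n (size u) T g (u ++ x :: v) =
  - (size v).+1%:R^-1 * picksum id (defect T g u x) [::] v.
Proof.
by move=> sz; rewrite /correction sz eqxx /= drop_size_cat // take_size_cat.
Qed.

Lemma correction_multilinear n j T : multilinears T ->
  multilinears (correction n j T).
Proof.
move=> TM g u v a x y.
have [sz|sz] := eqVneq (size (u ++ x :: v)) n; last first.
  rewrite /correction; rewrite !size_cat /= in sz *.
  by rewrite sz /= mulr0 addr0.
have szE z : size (u ++ z :: v) = n by rewrite -sz !size_cat.
have [uj|ju] := ltnP (size u) j.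
  rewrite /correction !szE eqxx /= !drop_cat !take_cat ltnNge ltnW //=.
  rewrite -(subnSK uj) /=; case: drop => [|z w]; first by rewrite mulr0 addr0.
  rewrite (@picksum_linear _ _ _ _ (defect T g (u ++ x :: take (j - (size u).+1) v) z)
    (defect T g (u ++ y :: take (j - (size u).+1) v) z) a); first by ring.
  by move=> t s; apply: (@defect_multilinear_l T g z t s TM).
have [u1 [u2 [uE <-]]] : exists u1 u2, u = u1 ++ u2 /\ size u1 = j.
  by exists (take j u), (drop j u); rewrite cat_take_drop size_takel.
move: szE; rewrite {}uE -!catA; case: u2 => [|z u2] szE /=.
  rewrite cats0 in szE; rewrite !correctionE //.
  rewrite (@picksum_linear _ _ _ _ (defect T g u1 x) (defect T g u1 y) a).
    by ring.
  by move=> t s; apply: defect_linear.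
rewrite !correctionE; try by rewrite -[RHS](szE 0) -catA !size_cat /= !size_cat.
rewrite (@picksum_multilinear _ _ id (defect T g u1 z) [::]).
- by rewrite !size_cat; ring.
- by move=> *; apply: defect_linear_r.
- by move=> *; apply: defect_multilinear_r.
- by [].
Qed.

(** From position [j] on, the defect is a 2-form in x, y with coefficients symmetric in the
    remaining letters. The hexagon says that it is closed, and [correction] is its Koszul primitive.
    Later positions stay straight because the correction is symmetric in the letters after [j]. *)
Lemma straighten_position n j T : multilinears T -> straight n T ->
  straight_at n.+1 j.+1 T ->
  exists T', [/\ multilinears T',
    forall g s, size s != n.+1 -> T' g s = T g s & straight_at n.+1 j T'].
Proof.
move=> TM Tn Tj; exists (fun g s => T g s + correction n.+1 j T g s); split.
- by move=> g u v a x y; rewrite TM (correction_multilinear _ _ TM); ring.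
- by move=> g s /negPf sz; rewrite /correction sz addr0.
move=> g u x y v sz szu.
have szE : (size u + size v).+2 = n.+1 by rewrite -sz size_cat /= !addnS.
have sz' : size (u ++ y :: x :: v) = n.+1 by rewrite -sz !size_cat.
rewrite /defect (@eq_bracket_term n.-1 T); first last.
- by lia.
- by move=> h s szs; rewrite /correction ifT ?addr0 //; lia.
apply: (etrans (y := defect T g u x y v
    + (correction n.+1 j T g (u ++ x :: y :: v)
       - correction n.+1 j T g (u ++ y :: x :: v)))); first by rewrite /defect; ring.
have szk : (size v).+2%:R != 0 :> K by exact: charK.
move: szu; rewrite leq_eqVlt => /predU1P[ju|ju].
  rewrite ju !correctionE //= !(@picksum_prefix _ _ _ _ [:: _] [::]) /=.
  (* By the hexagon each letter of v yields one copy of the defect; the two copies from antisymmetry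
     complete the denominator [(size v).+2]. *)
  have sumE : picksum id (fun z s => defect T g u x z (y :: s)) [::] v
      - picksum id (fun z s => defect T g u y z (x :: s)) [::] v
      = (size v)%:R * defect T g u x y v.
    have defS : symmetric_at (size v) (defect T g u x y).
      have -> : size v = (n.+1 - (size u).+2)%N by lia.
      by apply: (@defect_symmetric n j T g u x y Tn Tj); rewrite ju.
    rewrite -(picksum_self (w := [::]) defS) //.
    case: v szE {sz sz' szk} defS => [|t v] szE defS; first by rewrite /= subrr.
    have E z s : size s = size v -> defect T g u x y (z :: s)
        = (-1) * defect T g u y z (x :: s) + defect T g u x z (y :: s).
      move=> szs; have := defect_hexagon g u x y z s TM.
      (* The three hexagon terms one position further right vanish by [Tj]. *)
      rewrite !(Tj _ (rcons _ _)) ?cat_rcons ?size_rcons ?ju //; try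
        by move: szE; rewrite !size_cat /= szs; lia.
      by rewrite !addr0 add0r => <-; ring.
    rewrite (eq_picksum _ E) // [RHS](@picksum_linear _ _ _ _
      (fun z s => defect T g u y z (x :: s))
      (fun z s => defect T g u x z (y :: s)) (-1)) //; ring.
  rewrite (defectC T g u x y); move/eqP: sumE; rewrite subr_eq => /eqP->.
  by rewrite -addn2 natrD in szk *; field.
have [u1 [z [u2 [uE ju1]]]] : exists u1 z u2, u = u1 ++ z :: u2 /\ size u1 = j.
  case dE: (drop j u) => [|z u2]; last first.
    by exists (take j u), z, u2; rewrite -dE cat_take_drop size_takel // ltnW.
  by have := size_drop j u; rewrite dE /=; lia.
rewrite (_ : defect _ _ _ _ _ _ = 0) ?add0r; last exact: Tj.
rewrite uE -!catA !cat_cons -ju1 !correctionE; try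
  by rewrite -sz uE -!catA !size_cat /= !size_cat.
rewrite !size_cat /= -mulrBr [X in _ * X](_ : _ = 0) ?mulr0 //.
apply/eqP; rewrite subr_eq0; apply/eqP.
apply: (@picksum_symmetric _ _ (n.+1 - (size u1).+2) (n.+1 - (size u1).+2)) => //.
- by move=> t; apply: (@defect_symmetric n j) => //; rewrite ju1.
- move=> t t' w w' szw; rewrite addrC; congr (_ + _).
- by move: szE; rewrite uE !size_cat /=; lia.
Qed.

Lemma straighten n T : multilinears T -> straight n T ->
  exists2 T', multilinears T' /\ straight n.+1 T' &
    forall g s, (size s <= n)%N -> T' g s = T g s.
Proof.
move=> TM Tn.
(* For [j = 0] the condition is vacuous; for [j = n.+1] it covers every position. *)
suff H j : exists2 T', multilinears T' /\ straight_at n.+1 (n.+1 - j) T' &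
    forall g s, size s != n.+1 -> T' g s = T g s.
  have [T' [T'M T'n] eqT] := H n.+1; rewrite subnn in T'n.
  exists T'; last by move=> g s szs; rewrite eqT // neq_ltn ltnS szs.
  split=> // m; rewrite leq_eqVlt => /predU1P[->//|]; rewrite ltnS => mn.
  move=> g u x y v sz _; rewrite /defect !eqT.
  - rewrite (@eq_bracket_term n T); first exact: (Tn m).
    + by move=> h s szs; rewrite eqT // neq_ltn ltnS szs.
    + by move: sz; rewrite size_cat /=; lia.
  - by move: sz; rewrite !size_cat /=; lia.
  - by move: sz; rewrite !size_cat /=; lia.
elim: j => [|j [T1 [T1M T1j] eqT]].
  exists T => //; split=> // g u x y v; rewrite size_cat /=; lia.
have [nj|jn] := leqP n.+1 j.
  exists T1 => //; split=> //; have -> : (n.+1 - j.+1 = n.+1 - j)%N by lia.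
  by [].
have T1n : straight n T1.
  move=> m mn g u x y v sz _; rewrite /defect !eqT; last 2 first.
  - by move: sz; rewrite !size_cat /=; lia.
  - by move: sz; rewrite !size_cat /=; lia.
  rewrite (@eq_bracket_term n T); first exact: (Tn m).
  - by move=> h s szs; rewrite eqT // neq_ltn ltnS szs.
  - by move: sz; rewrite size_cat /=; lia.
rewrite subSn // in T1j.
have [T' [T'M eqT' T'j]] := straighten_position T1M T1n T1j.
exists T'; first by rewrite subSS.
by move=> g s szs; rewrite eqT' // eqT.
Qed.

Lemma straighten_all n T : multilinears T -> straight n T ->
  exists2 T', multilinears T' /\ (forall m, straight m T') &
    forall g s, (size s <= n)%N -> T' g s = T g s.
Proof.
move=> TM Tn.
have [] := @stable_limit (G * seq V) K (fun a => size a.2)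
  (fun m (W : G * seq V -> K) =>
     multilinears (fun g s => W (g, s)) /\ straight m (fun g s => W (g, s)))
  n (fun a => T a.1 a.2).
- move=> m T1 [/straighten H /H[T' [T'M T'n] eqT]].
  by exists (fun a => T' a.1 a.2) => // -[g s]; apply: eqT.
- by [].
move=> T' eqT T'E; exists (fun g s => T' (g, s)); last by move=> g s /(eqT (g, s)).
split=> [g u v a x y|m].
  have [Tm [TmM _] TmE] := T'E _ (leq_addr (size (u ++ x :: v)) n).
  rewrite !TmE ?TmM //=; by rewrite !size_cat /=; lia.
move=> k km g u x y v sz _.
have [Tm [TmM Tms] TmE] := T'E _ (leq_addr m n).
rewrite -[RHS](Tms _ (leq_trans km (leq_addl n m)) g u x y v sz) //.
rewrite /defect !TmE /=; last 2 first.
- by move: sz; rewrite !size_cat /=; lia.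
- by move: sz; rewrite !size_cat /=; lia.
rewrite (@eq_bracket_term m (fun g s => Tm (g, s))) //.
- by move=> h s szs; rewrite TmE //= (leq_trans szs) ?leq_addl.
- by move: sz; rewrite size_cat /=; lia.
Qed.

End Straightening.

(** * Functionals on presented algebras *)

(* Stated for an abstract algebra spanned by a multiplicative family: unification
   on the concrete monoid algebra is prohibitively slow. *)
Section SpanningMonoid.
Variables (K : fieldType) (B : lalgType K) (M : Type) (mul : M -> M -> M).
Variable mono : M -> B.
Hypothesis monoM : forall m n, mono m * mono n = mono (mul m n).
Hypothesis monoAr : forall c m n, mono m * (c *: mono n) = c *: (mono m * mono n).
Hypothesis mono_span : forall P : B -> Prop, P 0 ->
  (forall f g, P f -> P g -> P (f + g)) -> (forall c m, P (c *: mono m)) ->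
  forall f, P f.
Implicit Types (f g : B) (m n : M).

Lemma span_scaleAr (c : K) f g : c *: (f * g) = f * (c *: g).
Proof.
move: f; apply: mono_span => [|f1 f2 IH1 IH2|d m].
- by rewrite !mul0r scaler0.
- by rewrite !mulrDl scalerDr IH1 IH2.
move: g; apply: mono_span => [|g1 g2 IH1 IH2|e n].
- by rewrite scaler0 mulr0 scaler0.
- by rewrite scalerDr !mulrDr scalerDr IH1 IH2.
by rewrite scalerA -!scalerAl !monoAr !scalerA; congr (_ *: _); ring.
Qed.

Variable l : B -> K.
Hypothesis lD : forall f g, l (f + g) = l f + l g.
Hypothesis lZ : forall c f, l (c *: f) = c * l f.

(** In the free algebra this is the largest two-sided ideal inside the kernel of [l], tested against
    monomials only. *)
Definition two_sided_null f := forall m n, l (mono m * f * mono n) = 0.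

Lemma two_sided_null0 : two_sided_null 0.
Proof. by move=> m n; rewrite mulr0 mul0r -(scale0r 0) lZ mul0r. Qed.

Lemma two_sided_nullB f g :
  two_sided_null f -> two_sided_null g -> two_sided_null (f - g).
Proof.
move=> f0 g0 m n.
by rewrite mulrBr mulrBl -scaleN1r lD lZ f0 g0 mulr0 addr0.
Qed.

Lemma two_sided_nullMl f g : two_sided_null g -> two_sided_null (f * g).
Proof.
move=> g0; move: f; apply: mono_span => [|f1 f2 IH1 IH2|c k] m n.
- by rewrite mul0r; apply: two_sided_null0.
- by rewrite mulrDl mulrDr mulrDl lD IH1 IH2 addr0.
by rewrite mulrA monoAr -!scalerAl lZ monoM g0 mulr0.
Qed.

Lemma two_sided_nullMr f g : two_sided_null f -> two_sided_null (f * g).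
Proof.
move=> f0; move: g; apply: mono_span => [|g1 g2 IH1 IH2|c k] m n.
- by rewrite mulr0; apply: two_sided_null0.
- by rewrite !mulrDr mulrDl lD IH1 IH2 addr0.
by rewrite -!span_scaleAr -scalerAl lZ -!mulrA monoM mulrA f0 mulr0.
Qed.

End SpanningMonoid.

Section PresentedAlgebraTheory.
Variables (K : fieldType) (X : choiceType).
Local Notation free_alg := {malg K[{fmonom X}]}.
Implicit Types (f g : free_alg) (m n : {fmonom X}).

Lemma malg_mulU1 m n : << m >> * << n >> = << mmul m n >> :> free_alg.
Proof. by rewrite malgM_def fgmulUU mulr1. Qed.

Lemma malg_scaleU (c : K) m : c *: << m >> = << c *g m >> :> free_alg.
Proof. by apply/malgP => k; rewrite mcoeffZ !mcoeffU mulrnAr mulr1. Qed.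

Lemma malg_scaleUAr (c : K) m n :
  << m >> * (c *: << n >>) = c *: (<< m >> * << n >>) :> free_alg.
Proof. by rewrite malg_mulU1 !malg_scaleU malgM_def fgmulUU mul1r. Qed.

Lemma malg_span (P : free_alg -> Prop) :
  P 0 -> (forall f g, P f -> P g -> P (f + g)) ->
  (forall c m, P (c *: << m >>)) -> forall f, P f.
Proof.
move=> P0 PD PU f; rewrite (monalgE f); apply: big_ind => // m _.
by rewrite -malg_scaleU.
Qed.

Lemma malg_scaleAr (c : K) f g : c *: (f * g) = f * (c *: g).
Proof. exact: (span_scaleAr malg_scaleUAr malg_span). Qed.

Lemma malg_functional (h : {fmonom X} -> K) : exists l : free_alg -> K,
  [/\ forall f g, l (f + g) = l f + l g, forall c f, l (c *: f) = c * l f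
    & forall m, l << m >> = h m].
Proof.
exists (mmap idfun h); split=> [|c f|m]; first exact: raddfD.
  rewrite (mmapEw (msuppZ_le _ _)) mmapE mulr_sumr.
  by apply: eq_bigr => m _; rewrite mcoeffZ mulrA.
by rewrite mmapU mul1r.
Qed.

Variable rel : free_alg -> Prop.
Local Notation A := (pres_alg rel).
Local Notation pi := (@pres_pi K X rel).

Lemma pres_piM f g : pi (f * g) = pi f * pi g.
Proof. exact: pres_pi_mul. Qed.

Lemma pres_piZ c f : pi (c *: f) = c *: pi f.
Proof. exact: pres_pi_scale. Qed.

Lemma pres_pi_rel f : rel f -> pi f = 0.
Proof.
move=> relf; rewrite -(raddf0 (@pres_pi K X rel)); apply/pres_piE.
by rewrite subr0; apply/rel_idealP/RelIdealGen.
Qed.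

Lemma pres_scaleAl c (a b : A) : c *: (a * b) = c *: a * b.
Proof.
rewrite -(pres_reprK a) -(pres_reprK b) -pres_piM -!pres_piZ -pres_piM.
by rewrite -scalerAl.
Qed.

Lemma pres_scaleAr c (a b : A) : c *: (a * b) = a * (c *: b).
Proof.
rewrite -(pres_reprK a) -(pres_reprK b) -pres_piM -!pres_piZ -pres_piM.
by rewrite malg_scaleAr.
Qed.

Lemma pres_functional (l : free_alg -> K) :
  (forall f g, l (f + g) = l f + l g) -> (forall c f, l (c *: f) = c * l f) ->
  (forall f m n, rel f -> l (<< m >> * f * << n >>) = 0) ->
  exists t : {linear A -> K^o}, forall f, t (pi f) = l f.
Proof.
move=> lD lZ l_rel.
have lB f g : l (f - g) = l f - l g by rewrite -scaleN1r lD lZ mulN1r.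
have lI f : f \in rel_ideal rel -> l f = 0.
  move=> /rel_idealP If.
  suff J : two_sided_null (fun m : {fmonom X} => << m >>) l f.
    by have := J mone mone; rewrite mulr1 mul1r.
  elim: If => {f} [f relf|| f g _ If _ Ig|f g _ Ig|f g _ If].
  - by move=> m n; apply: l_rel.
  - exact: two_sided_null0.
  - exact: two_sided_nullB.
  - exact: (two_sided_nullMl malg_mulU1 malg_scaleUAr malg_span).
  - exact: (two_sided_nullMr malg_mulU1 malg_scaleUAr malg_span).
pose t (a : A) : K^o := l (pres_repr a).
have tE f : t (pi f) = l f.
  by apply/eqP; rewrite -subr_eq0 -lB; apply/eqP/lI/pres_repr_pi.
have tL : linear t.
  move=> c a b; rewrite -(pres_reprK a) -(pres_reprK b) -pres_piZ -raddfD !tE.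
  by rewrite lD lZ.
exists (HB.pack_for {linear A -> K^o} t (GRing.isLinear.Build _ _ _ _ t tL)).
exact: tE.
Qed.

End PresentedAlgebraTheory.

(** * Twisted traces on words *)

Section TwistedTraces.
Variables (K : fieldType) (V : lmodType K) (G : finGroupType).
Variables (act : G -> V -> V) (b : G -> V -> V -> K).
Hypothesis charK : forall n, n.+1%:R != 0 :> K.
Hypothesis actL : forall g, linear (act g).
Hypothesis act1 : forall x, act 1%g x = x.
Hypothesis actM : forall g h x, act (g * h)%g x = act g (act h x).
Hypothesis bL : forall g a x y z, b g (a *: x + y) z = a * b g x z + b g y z.
Hypothesis bC : forall g x y, b g x y = - b g y x.
Hypothesis bJ : forall g h x y, b (g ^ h^-1)%g (act h x) (act h y) = b g x y.
Hypothesis bjacobi : forall g x y z,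
  b g x y *: (act g z - z) + b g y z *: (act g x - x)
  + b g z x *: (act g y - y) = 0.
Variable kappa : K.
Hypothesis kappa2 : kappa * kappa = 1.
(* [p g] is the projection onto Ker (1 - kappa g) along Im (1 - kappa g), [d g]
   its rank, and [theta g] inverts 1 - kappa g modulo [p g]. *)
Variables (p theta : G -> V -> V) (d : G -> nat).
Hypothesis pL : forall g, linear (p g).
Hypothesis thetaL : forall g, linear (theta g).
Hypothesis act_p : forall g x, kappa *: act g (p g x) = p g x.
Hypothesis p_id : forall g x, kappa *: act g x = x -> p g x = x.
Hypothesis p_im : forall g x, p g (x - kappa *: act g x) = 0.
Hypothesis act_theta : forall g x,
  theta g x - kappa *: act g (theta g x) = x - p g x.
Hypothesis theta_im : forall g x, theta g (x - kappa *: act g x) = x - p g x.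
Hypothesis pJ : forall g h x, p (g ^ h^-1)%g (act h x) = act h (p g x).
Hypothesis dJ : forall g h, d (g ^ h^-1)%g = d g.
Hypothesis d_decr : forall g r x y, r != 1%g -> kappa *: act g x = x ->
  b r x y != 0 -> (d (r * g)%g < d g)%N.
Hypothesis p_adj : forall g x y, b 1%g (p g x) y = b 1%g x (p g y).
Hypothesis d_eq0 : forall g x, d g = 0%N -> p g x = 0.
Variables (J : finType) (e f : J -> V).
Hypothesis sum_fe : forall x, \sum_j b 1%g (f j) x *: e j = x.
Hypothesis sum_ef : forall x, \sum_j b 1%g x (e j) *: f j = x.
Hypothesis sum_p : forall g, \sum_j b 1%g (p g (f j)) (e j) = (d g)%:R.
Implicit Types (T : G -> seq V -> K) (s u v w : seq V) (x y z : V) (g h r : G).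

Definition functional T := multilinears T /\ forall n, straight act b n T.

Definition vanishes n T := forall g s, (size s < n)%N -> T g s = 0.

Definition invariant_functional T :=
  forall h g s, T (g ^ h^-1)%g (map (act h) s) = T g s.

(* If T records t, then [twist x T] records a |-> t (x a - kappa a x). *)
Definition twist x T g s := T g (x :: s) - kappa * T g (rcons s (act g x)).

(** As [g ^ h^-1] is $h g h^{-1}$, this records $a \mapsto t(h a h^{-1})$. *)
Definition conj_functional h T g s := T (g ^ h^-1)%g (map (act h) s).

Lemma functional_swap T g u x y v : functional T ->
  T g (u ++ x :: y :: v) = T g (u ++ y :: x :: v) + bracket_term act b T g u x y v.
Proof. by move=> [_ Ts]; exact: (@straightE _ _ _ act b _ 0 T g u x y v (Ts _ _ (leqnn _))). Qed.

Lemma functionalP T : multilinears T ->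
  (forall g u x y v, T g (u ++ x :: y :: v)
     = T g (u ++ y :: x :: v) + bracket_term act b T g u x y v) -> functional T.
Proof.
move=> TM Ts; split=> // n m _ g u x y v _ _; rewrite /defect Ts; ring.
Qed.

Lemma eq_functional T T' : (forall g s, T g s = T' g s) ->
  functional T -> functional T'.
Proof.
move=> E FT; apply: functionalP => [g u v a x y|g u x y v].
  by rewrite -!E FT.1.
rewrite -!E functional_swap //; congr (_ + _).
by apply: eq_bigr => r _; rewrite E.
Qed.

Lemma functional_linear a T T' : functional T -> functional T' ->
  functional (fun g s => a * T g s + T' g s).
Proof.
move=> FT FT'; apply: functionalP => [g u v c x y|g u x y v].
  by rewrite FT.1 FT'.1; ring.
rewrite (functional_swap _ _ _ _ _ FT) (functional_swap _ _ _ _ _ FT').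
rewrite [X in _ = _ + X](_ : _ = a * bracket_term act b T g u x y v
  + bracket_term act b T' g u x y v); first by ring.
by rewrite mulr_sumr -big_split; apply: eq_bigr => r _ /=; ring.
Qed.

Lemma functional_sum (I : Type) (rr : seq I) (Ts : I -> G -> seq V -> K) :
  (forall i, functional (Ts i)) ->
  functional (fun g s => \sum_(i <- rr) Ts i g s).
Proof.
move=> FT; elim: rr => [|i rr IH].
  apply: functionalP => [g u v a x y|g u x y v].
    by rewrite !big_nil mulr0 addr0.
  by rewrite !big_nil /bracket_term big1 ?addr0 // => r _; rewrite big_nil mulr0.
apply: eq_functional (functional_linear 1 (FT i) IH) => g s.
by rewrite big_cons mul1r.
Qed.

Lemma conj_functionalP h T : functional T -> functional (conj_functional h T).
Proof.
move=> FT; apply: functionalP => [g u v a x y|g u x y v]; rewrite /conj_functional.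
  by rewrite !map_cat /= actL FT.1.
rewrite !map_cat /= functional_swap //; congr (_ + _).
rewrite /bracket_term (reindex_inj (conjg_inj h^-1%g)) /=.
apply: eq_bigr => r _; rewrite bJ conjMg map_cat -!map_comp.
congr (_ * T _ (_ ++ _)); apply: eq_map => z /=.
by rewrite -!actM conjgE invgK !mulgA mulgKV.
Qed.

Lemma twist_functional z T : functional T -> functional (twist z T).
Proof.
move=> FT; apply: functionalP => [g u v a x y|g u x y v]; rewrite /twist.
  rewrite (FT.1 g (z :: u)) !rcons_cat !rcons_cons.
  by rewrite FT.1 /=; ring.
rewrite (functional_swap g (z :: u)) // !rcons_cat !rcons_cons.
rewrite (functional_swap g u x y (rcons _ _)) //.
rewrite [X in _ = _ + X](_ : _ = bracket_term act b T g (z :: u) x y v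
  - kappa * bracket_term act b T g u x y (rcons v (act g z))); first by rewrite /=; ring.
rewrite mulr_sumr -sumrB; apply: eq_bigr => r _.
by rewrite map_rcons -rcons_cat actM; ring.
Qed.

(** By [kappa2] the two sides differ by t (a[x, y]) - t ([x, y]a). Since [x, y] is a combination of
    group elements, invariance makes this 0. *)
Lemma twist_comm x y T : functional T -> invariant_functional T ->
  forall g s, twist x (twist y T) g s = twist y (twist x T) g s.
Proof.
move=> FT iT g s; rewrite /twist !rcons_cons.
have := functional_swap g [::] y x s FT; rewrite /= => ->.
have := functional_swap g s (act g x) (act g y) [::] FT.
rewrite -!cats1 -!catA /= => ->.
have -> : bracket_term act b T g [::] y x s
    = - bracket_term act b T g s (act g x) (act g y) [::].
  rewrite -bracket_termC // /bracket_term [RHS](reindex_inj (conjg_inj g^-1%g)) /=.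
  apply: eq_bigr => r _; rewrite bJ cats0 /=.
  have -> : (r ^ g^-1 * g = g * r)%g by rewrite conjgE invgK mulgA mulgKV.
  rewrite -(iT r (g * r)%g s); congr (_ * T _ _).
  by rewrite conjgE invgK !mulgA mulgK.
by ring: kappa2.
Qed.

Lemma functional_symmetric T n : functional T ->
  (forall g s, (size s).+2 = n -> T g s = 0) -> forall g, symmetric_at n (T g).
Proof.
move=> FT T0 g u v x y sz; rewrite functional_swap //.
rewrite /bracket_term big1 ?addr0 // => r _; rewrite T0 ?mulr0 //.
by rewrite -sz !size_cat size_map /= !addnS.
Qed.

(** As [T] is 0 in degree |s| - 1, no commutator contributes: [T g] is symmetric in degree |s| + 1
    and the last letter may move to the front. *)
Lemma twist_lead T x g s : functional T ->
  (forall g s', (size s').+1 = size s -> T g s' = 0) ->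
  twist x T g s = T g ((x - kappa *: act g x) :: s).
Proof.
move=> FT T0; have TS : symmetric_at (size s).+1 (T g).
  by apply: functional_symmetric => // h s' [/T0].
rewrite /twist -cats1 (symmetric_front TS) ?size_cat ?addn1 // cats0.
rewrite (multilinearB [::] _ _ _ (FT.1 g)) /=.
by rewrite (multilinearZ [::] _ _ _ (FT.1 g)).
Qed.

(* If no reflection contributes, moving x from the front of a word to its end
   is the derivation of S(V) given by the form b 1 x. *)
Lemma functional_derivation T x g s : functional T ->
  (forall r y s', r != 1%g -> (size s').+1 = size s ->
     b r x y * T (r * g)%g s' = 0) ->
  T g (x :: s) - T g (rcons s x)
  = picksum id (fun y s' => b 1%g x y * T g s') [::] s.
Proof.
move=> FT T0.
suff H w : (forall r y s', r != 1%g -> (size s').+1 = (size w + size s)%N ->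
     b r x y * T (r * g)%g s' = 0) ->
  T g (w ++ x :: s) - T g (w ++ rcons s x)
  = picksum id (fun y s' => b 1%g x y * T g s') w s by rewrite -(H [::]).
elim: s w {T0} => [|y s IH] w T0 /=; first by rewrite subrr.
rewrite functional_swap //= -!(cat_rcons y) addrAC IH; last first.
  by move=> r z s' r1 szs'; apply: T0; rewrite // szs' size_rcons addSnnS.
rewrite addrC; congr (_ + _).
rewrite /bracket_term (bigD1 1%g) //= mul1g big1 ?addr0 => [|r r1].
  congr (_ * T g (_ ++ _)); rewrite -[RHS]map_id; apply: eq_map => z.
  exact: act1.
by apply: T0; rewrite // size_cat size_map addnS.
Qed.

(** Corrections are extended to functionals without regard to conjugation; averaging restores
    invariance and keeps the values and equations that are themselves stable under conjugation. *)
Definition average T g s := #|G|%:R^-1 * \sum_h conj_functional h T g s.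

Lemma cardG_neq0 : #|G|%:R != 0 :> K.
Proof. by rewrite -cardsT -(prednK (cardG_gt0 [set: G])). Qed.

Lemma average_functional T : functional T -> functional (average T).
Proof.
move=> FT; have F0 : functional (fun _ _ => 0).
  apply: functionalP => [g u v a x y|g u x y v]; first by rewrite mulr0 addr0.
  by rewrite /bracket_term big1 ?addr0 // => r _; rewrite mulr0.
have FS := functional_sum (index_enum G) (fun h => conj_functionalP h FT).
apply: eq_functional (functional_linear #|G|%:R^-1 FS F0) => g s.
by rewrite addr0.
Qed.

Lemma average_invariant T : invariant_functional (average T).
Proof.
move=> k g s; congr (_ * _); rewrite [RHS](reindex_inj (mulIg k)) /=.
apply: eq_bigr => h _; rewrite /conj_functional -conjgM -invMg -map_comp.
by congr (T _ _); apply: eq_map => x /=; rewrite actM.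
Qed.

Lemma average_id T c g s :
  (forall h, T (g ^ h^-1)%g (map (act h) s) = c) -> average T g s = c.
Proof.
move=> Tc; rewrite /average (eq_bigr _ (fun h _ => Tc h)) sumr_const.
by rewrite -[c *+ _]mulr_natl mulKf // cardG_neq0.
Qed.

Lemma twist_conj h x T g s :
  twist x (conj_functional h T) g s = twist (act h x) T (g ^ h^-1)%g (map (act h) s).
Proof.
rewrite /twist /conj_functional map_rcons /= -!actM.
by rewrite conjgE invgK mulgA mulgKV.
Qed.

Lemma twist_average x T g s :
  (forall h, twist (act h x) T (g ^ h^-1)%g (map (act h) s) = 0) ->
  twist x (average T) g s = 0.
Proof.
move=> T0; rewrite /twist /average mulrCA -mulrBr mulr_sumr -sumrB big1 ?mulr0 // => h _.
by rewrite -[RHS](T0 h) -twist_conj.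
Qed.

Lemma twist_multilinear T g x : functional T -> multilinear (twist x T g).
Proof. by move=> FT; have [] := twist_functional x FT. Qed.

Lemma twist_linear T g s a x y : functional T ->
  twist (a *: x + y) T g s = a * twist x T g s + twist y T g s.
Proof.
move=> FT; rewrite /twist actL (FT.1 g [::]) /=.
by rewrite -!cats1 (FT.1 g s [::]); ring.
Qed.

(* The PBW property. *)
Lemma symmetric_extension n (tau : G -> seq V -> K) :
  (forall g, multilinear (tau g)) -> (forall g, symmetric_at n (tau g)) ->
  exists T, [/\ functional T, forall g s, size s = n -> T g s = tau g s
    & vanishes n T].
Proof.
move=> tauM tauS; pose T0 g s := if size s == n then tau g s else 0.
have T0M : multilinears T0.
  move=> g u v a x y; rewrite /T0 !size_cat /=.
  by case: ifP => _; rewrite ?tauM // mulr0 addr0.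
(* Bracket terms of words of length at most n have length below n, where [T0] is 0. *)
have T0s : straight act b n T0.
  move=> k kn g u x y v sz _; rewrite /defect /bracket_term big1 ?subr0.
    rewrite /T0; have -> : size (u ++ y :: x :: v) = k by rewrite -sz !size_cat.
    rewrite sz; case: eqP => [kE|_]; last by rewrite subrr.
    by apply/eqP; rewrite subr_eq0; apply/eqP/tauS; rewrite -kE.
  move=> r _; rewrite /T0 ifF ?mulr0 //; apply/eqP.
  by move: sz; rewrite !size_cat size_map /=; lia.
have [T [TM Ts] TE] :=
  straighten_all charK actL actM bL bC bJ bjacobi T0M T0s.
exists T; split=> // [g s szs|g s szs].
  by rewrite TE ?szs // /T0 szs eqxx.
by rewrite TE ?(ltnW szs) // /T0 ltn_eqF.
Qed.

(* The equations on the new top degree part are solved by transporting all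
   letters, one at a time, into the image of 1 - kappa g. *)
Lemma perp_step m T : functional T -> invariant_functional T ->
  (forall x, vanishes m (twist x T)) ->
  exists T', [/\ functional T', invariant_functional T',
    forall g s, (size s <= m)%N -> T' g s = T g s &
    forall g x s, p g x = 0 -> (size s <= m)%N -> twist x T' g s = 0].
Proof.
move=> FT iT Tm.
pose phi g x s := - twist x T g s.
have phiM g x : multilinear (phi g x).
  by move=> u v a y z; rewrite /phi twist_multilinear //; ring.
have phiL g s a x y : phi g (a *: x + y) s = a * phi g x s + phi g y s.
  by rewrite /phi twist_linear //; ring.
have phiS g x : symmetric_at m (phi g x).
  move=> u v y z sz; congr (- _).
  by apply: functional_symmetric sz; [exact: twist_functional|move=> h s szs; apply: Tm; lia].
(* Up to sign the two sides are the double twists in the two orders. *)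
have phi_lead g x y s : (size s).+1 = m ->
    phi g x ((y - kappa *: act g y) :: s) = phi g y ((x - kappa *: act g x) :: s).
  move=> szs; rewrite /phi -!twist_lead; try exact: twist_functional.
  - by rewrite twist_comm.
  - by move=> h s' szs'; apply: Tm; lia.
  - by move=> h s' szs'; apply: Tm; lia.
(* Forced by telescoping: each letter x is p x + (1 - kappa g)(theta x), the second part is
   evaluated by the required equation, and letters already treated remain as p x. Words consisting
   only of fixed letters get the value 0. *)
pose tau g := picksum (p g) (fun x => phi g (theta g x)) [::].
have tauM g : multilinear (tau g).
  apply: picksum_multilinear => // s a x y; first by rewrite thetaL phiL.
have tauS g : symmetric_at m.+1 (tau g).
  apply: (@picksum_symmetric _ _ m) => // x y u v sz.
  have sz' z : size (u ++ z :: v) = m by rewrite -sz !size_cat.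
  have E : phi g (theta g x) (u ++ (y - p g y) :: v)
      = phi g (theta g y) (u ++ (x - p g x) :: v).
    rewrite !(symmetric_front (phiS g _)) // -!act_theta phi_lead //.
    by move: sz; rewrite !size_cat /=; lia.
  move: E; rewrite !multilinearB // => E.
  by rewrite (canRL (subrK _) E); ring.
have [U [FU UE U0]] := symmetric_extension tauM tauS.
pose T1 g s := 1 * U g s + T g s.
have FT1 : functional T1 by apply: functional_linear.
have T1E g s : (size s <= m)%N -> T1 g s = T g s.
  by move=> szs; rewrite /T1 U0 ?mulr0 ?add0r.
have tw1 g x s : p g x = 0 -> (size s <= m)%N -> twist x T1 g s = 0.
  move=> px0; rewrite leq_eqVlt => /predU1P[szs|szs]; last first.
    by rewrite -[RHS](Tm x g s szs) /twist !T1E // size_rcons.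
  have -> : twist x T1 g s = twist x U g s + twist x T g s.
    by rewrite /twist /T1; ring.
  rewrite twist_lead //; last by move=> h s' szs'; apply: U0; lia.
  (* Every summand but the first contains the letter p (x - kappa g x) = 0. *)
  rewrite UE /= ?szs // /tau /= theta_im px0 subr0 p_im.
  by rewrite picksum0l ?addr0 ?addNr // => y; apply: phiM.
exists (average T1); split.
- exact: average_functional.
- exact: average_invariant.
- by move=> g s szs; apply: average_id => h; rewrite T1E ?size_map // iT.
- move=> g x s px0 szs; apply: twist_average => h; apply: tw1.
    by rewrite pJ px0 (act0 actL).
  by rewrite size_map.
Qed.

(** * The equations in the fixed directions *)

Lemma p_idem g x : p g (p g x) = p g x.
Proof. by apply: p_id; apply: act_p. Qed.

Lemma p_sub g x y : p g (x - y) = p g x - p g y.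
Proof. by rewrite addrC -scaleN1r pL scaleN1r addrC. Qed.

Lemma p_residue g x : p g (x - p g x) = 0.
Proof. by rewrite p_sub p_idem subrr. Qed.

Lemma p_sum g (c : J -> K) (X : J -> V) :
  p g (\sum_j c j *: X j) = \sum_j c j *: p g (X j).
Proof.
elim/big_rec2: _ => [|j _ y _ <-]; last exact: pL.
by have := pL g (-1) 0 0; rewrite scaler0 addr0 scaleN1r addNr.
Qed.

Lemma twist_split T g x s : functional T ->
  twist x T g s = twist (p g x) T g s + twist (x - p g x) T g s.
Proof.
by move=> FT; rewrite -[X in _ = X + _]mul1r -twist_linear // scale1r addrC subrK.
Qed.

Lemma twist_fixed T g x s : functional T -> kappa *: act g x = x ->
  twist x T g s = T g (x :: s) - T g (rcons s x).
Proof.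
move=> FT gx; rewrite /twist -!cats1 -[in RHS]gx -(multilinearZ s) //.
  by rewrite gx.
by have [] := FT.
Qed.

Lemma twist_fixed0 T g x s : functional T -> kappa *: act g x = x ->
  (forall h s', (size s').+1 = size s -> T h s' = 0) -> twist x T g s = 0.
Proof.
move=> FT gx T0; rewrite twist_lead // gx subrr.
exact: (multilinear0 [::] s (FT.1 g)).
Qed.

Lemma twist_derivation T g x s : functional T -> kappa *: act g x = x ->
  (forall r y s', (d (r * g) < d g)%N -> (size s').+1 = size s ->
     T (r * g)%g s' = 0) ->
  twist x T g s = picksum id (fun y s' => b 1%g x y * T g s') [::] s.
Proof.
move=> FT gx T0; rewrite twist_fixed // functional_derivation // => r y s' r1 szs'.
have [->|bn0] := eqVneq (b r x y) 0; first by rewrite mul0r.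
by rewrite T0 ?mulr0 //; apply: d_decr bn0.
Qed.

(* Euler's identity in the fixed directions: T g of degree n is recovered from
   its derivations; [d g] is the trace of [p g]. *)
Lemma euler g n (q : seq V -> K) s : multilinear q -> symmetric_at n q ->
  (forall x s', (size s').+1 = n -> q (p g x :: s') = q (x :: s')) ->
  size s = n ->
  \sum_j picksum id (fun x s' => b 1%g (p g (f j)) x * q s') [::] (p g (e j) :: s)
  = (d g + n)%:R * q s.
Proof.
move=> qM qS qp szs.
rewrite big_split /= natrD mulrDl; congr (_ + _).
  rewrite -mulr_suml -sum_p; congr (_ * _); apply: eq_bigr => j _.
  by rewrite -p_adj p_idem.
transitivity (picksum id (fun x s' => q (x :: s')) [::] s); last first.
  by rewrite (picksum_self qS) // szs.
transitivity (\sum_j 1 *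
    picksum id (fun x s' => b 1%g (p g (f j)) x * q (p g (e j) :: s')) [::] s).
  apply: eq_bigr => j _; rewrite mul1r.
  exact: (picksum_prefix id (fun x s' => b 1%g (p g (f j)) x * q s') [:: _] [::]).
rewrite -picksum_sum; case: s szs => [//|y s] szs.
apply: (@eq_picksum _ _ (size s)) => // x s' szs'.
rewrite -[RHS]qp; last by rewrite szs' -szs.
rewrite -[in RHS]p_idem.
rewrite -[in RHS](sum_fe (p g x)) p_sum (multilinear_sum [::] s') //=.
by apply: eq_bigr => j _; rewrite mul1r p_adj.
Qed.

(** In a fixed direction the terms of degree |s| + 1 cancel up to commutators, so only the values in
    degree |s| - 1 matter. *)
Lemma eq_twist_fixed T T' g x s : functional T -> functional T' ->
  kappa *: act g x = x ->
  (forall h s', (size s').+1 = size s -> T h s' = T' h s') ->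
  twist x T g s = twist x T' g s.
Proof.
move=> FT FT' gx E; apply/eqP; rewrite -subr_eq0; apply/eqP.
rewrite -(@twist_fixed0 (fun h s => (-1) * T' h s + T h s) g x s) //.
- by rewrite /twist; ring.
- exact: functional_linear.
- by move=> h s' szs'; rewrite E //; ring.
Qed.

(* The trace equations hold in degree < n and, in the fixed directions, also in
   degree n, and in degree n + 1 at the g with d g < k. *)
Definition good n k T := [/\ functional T, invariant_functional T,
  forall x, vanishes n (twist x T),
  forall g x s, kappa *: act g x = x -> (size s <= n)%N -> twist x T g s = 0 &
  forall g x s, (d g < k)%N -> kappa *: act g x = x -> (size s <= n.+1)%N ->
    twist x T g s = 0].

(** Two uses of [perp_step] choose the parts of degree n + 1 and n + 2. The equations in the fixed
    directions up to degree n + 1 see only degrees up to n, which are untouched. *)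
Lemma perp_good n k T : good n k T ->
  exists T', [/\ good n k T', forall g s, (size s <= n)%N -> T' g s = T g s,
    forall x, vanishes n.+1 (twist x T') &
    forall g x s, p g x = 0 -> (size s <= n.+1)%N -> twist x T' g s = 0].
Proof.
move=> [FT iT Tn Tfix Tk].
have [T1 [FT1 iT1 T1E T1perp]] := perp_step FT iT Tn.
have T1n x : vanishes n.+1 (twist x T1).
  move=> g s szs; rewrite twist_split // (T1perp g (x - p g x)) ?p_residue ?addr0 //.
  rewrite (@eq_twist_fixed T1 T) ?Tfix // => h s' szs'.
  by rewrite T1E // -ltnS szs' ltnW.
have [T2 [FT2 iT2 T2E T2perp]] := perp_step FT1 iT1 T1n.
have E g s : (size s <= n)%N -> T2 g s = T g s.
  by move=> szs; rewrite T2E ?T1E // leqW.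
have Efix g x s : kappa *: act g x = x -> (size s <= n.+1)%N ->
    twist x T2 g s = twist x T g s.
  move=> gx szs; apply: eq_twist_fixed => // h s' szs'.
  by rewrite E // -ltnS szs'.
exists T2; split=> //.
- split=> //.
  + move=> x g s szs; rewrite -[RHS](Tn x g s szs) /twist !E //.
    by rewrite size_rcons.
  + by move=> g x s gx szs; rewrite Efix ?Tfix // leqW.
  + by move=> g x s dg gx szs; rewrite Efix ?Tk.
- move=> x g s szs; rewrite twist_split // (T2perp g (x - p g x)) ?p_residue ?addr0 //.
    by rewrite Efix ?Tfix ?act_p // ltnW.
  exact: ltnW.
Qed.

(** The missing equations, at d g = k, prescribe the derivations of a degree n correction of [T g]
    along the fixed directions: a 1-form [F] on the fixed space. Values at R g enter only with d (R
    g) < d g, where all equations of the tentative extension hold, so commuting double twists make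
    [F] closed and Euler's identity integrates it. *)
Lemma fixed_step n k T : good n k T -> exists2 T', good n k.+1 T' &
  forall g s, (size s <= n)%N -> (size s < n)%N || (d g == 0)%N -> T' g s = T g s.
Proof.
case: k => [|k] gT.
  (* If d g = 0, the only fixed vector is 0. *)
  exists T => //; have [FT iT Tn Tfix _] := gT; split=> // g x s.
  rewrite ltnS leqn0 => /eqP dg gx _; rewrite (_ : x = 0).
    by have := twist_linear g s (-1) 0 0 FT; rewrite scaler0 addr0 mulN1r addNr.
  by rewrite -(p_id gx) d_eq0.
have [T2 [[FT2 iT2 T2n T2fix T2k] T2E T2n1 T2perp]] := perp_good gT.
have T2kk g x s : (d g < k.+1)%N -> (size s <= n.+1)%N -> twist x T2 g s = 0.
  move=> dg szs; rewrite twist_split // (T2perp g (x - p g x)) ?p_residue ?addr0 //.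
  by rewrite T2k // act_p.
have FtT2 x : functional (twist x T2) by apply: twist_functional.
pose F g x s := - twist (p g x) T2 g s.
have FM g x : multilinear (F g x).
  by move=> u v a y z; rewrite /F twist_multilinear //; ring.
have FL g s a x y : F g (a *: x + y) s = a * F g x s + F g y s.
  by rewrite /F pL twist_linear //; ring.
have FS g x : symmetric_at n.+1 (F g x).
  move=> u v y z sz; congr (- _); apply: functional_symmetric sz => // h s szs.
  by apply: T2n; lia.
(* Exchanging the twists leaves a twist in a fixed direction of a functional that vanishes in degree
   n - 1. Thus [F] depends only on the fixed parts of the letters. *)
have F0 g x y s : size s = n -> F g x ((y - kappa *: act g y) :: s) = 0.
  move=> szs; rewrite /F -twist_lead //; last by move=> h s' szs'; apply: T2n; lia.
  rewrite twist_comm // twist_fixed0 ?oppr0 ?act_p // => h s' szs'.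
  by apply: T2n1; lia.
have Fp g x y s : size s = n -> F g x (p g y :: s) = F g x (y :: s).
  move=> szs; apply/esym/eqP; rewrite -subr_eq0 -(multilinearB [::] s) //=.
  by rewrite -act_theta F0.
(* Closedness: the outer twist acts as a derivation on the inner one, whose values at R g with
   smaller d vanish in degree n + 1 by [T2kk]. *)
have Fkey g x y s : d g = k.+1 -> size s = n.+2 ->
    picksum id (fun z s' => b 1%g (p g x) z * F g y s') [::] s
    = picksum id (fun z s' => b 1%g (p g y) z * F g x s') [::] s.
  move=> dg szs.
  have H x' y' : picksum id (fun z s' => b 1%g (p g x') z * F g y' s') [::] s
      = - twist (p g x') (twist (p g y') T2) g s.
    rewrite twist_derivation ?act_p //; last first.
      by move=> r z s' dr szs'; apply: T2kk; [rewrite -dg|lia].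
    rewrite -mulN1r -[RHS]addr0.
    rewrite (@picksum_linear _ _ id _ (fun z s' => b 1%g (p g x') z * twist (p g y') T2 g s')
      (fun _ _ => 0) (-1)); last by move=> *; rewrite /F; ring.
    by rewrite picksum0.
  by rewrite !H twist_comm.
(* Euler's identity in degree n + 1 yields d g + n + 1 copies of [F]; one is subtracted with the
   terms in which the derivation hits the letter inserted from the dual basis. *)
pose c : K := (k.+1 + n)%:R^-1.
have c0 : (k.+1 + n)%:R != 0 :> K by apply: charK.
(* Only g with d g = k.+1 change, so the equations already solved at smaller d g and the values at d
   g = 0 survive. *)
pose tau g s := if d g == k.+1 then \sum_j c * F g (f j) (p g (e j) :: s) else 0.
have tauM g : multilinear (tau g).
  move=> u v a x y; rewrite /tau; case: ifP => _; last by rewrite mulr0 addr0.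
  rewrite mulr_sumr -big_split; apply: eq_bigr => j _ /=.
  by rewrite (FM g (f j) (_ :: u)) /=; ring.
have tauS g : symmetric_at n (tau g).
  move=> u v x y sz; rewrite /tau; case: ifP => // _.
  by apply: eq_bigr => j _; rewrite (FS g (f j) (_ :: u)) //= sz.
have tauE g x s : d g = k.+1 -> kappa *: act g x = x -> size s = n.+1 ->
    picksum id (fun y s' => b 1%g x y * tau g s') [::] s = F g x s.
  move=> dg gx szs.
  transitivity (picksum id (fun y s' =>
      \sum_j c * (b 1%g x y * F g (f j) (p g (e j) :: s'))) [::] s).
    apply: (@eq_picksum _ _ n) => // y s' _; rewrite /tau dg eqxx mulr_sumr.
    by apply: eq_bigr => j _; ring.
  rewrite picksum_sum -mulr_sumr.
  transitivity (c * (\sum_j (picksum id (fun y s' => b 1%g (p g (f j)) y * F g x s')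
      [::] (p g (e j) :: s) - b 1%g x (p g (e j)) * F g (f j) s))).
    congr (_ * _); apply: eq_bigr => j _.
    rewrite -(Fkey g x (f j) (p g (e j) :: s)) //= ?szs // (p_id gx).
    rewrite addrAC subrr add0r.
    by rewrite (picksum_prefix id (fun y s' => b 1%g x y * F g (f j) s') [:: _] [::]).
  rewrite sumrB (euler (n := n.+1)) //; last first.
    by move=> y s' [szs']; apply: Fp.
  have -> : \sum_j b 1%g x (p g (e j)) * F g (f j) s = F g x s.
    rewrite -[in RHS](p_id gx) -[in RHS](sum_ef (p g x)).
    elim/big_rec2: _ => [|j z y _ ->]; last by rewrite FL p_adj.
    by have := FL g s (-1) 0 0; rewrite scaler0 addr0 mulN1r addNr.
  by rewrite dg addnS -natr1 mulrDl mul1r addrK mulrA mulVf ?mul1r.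
have [U [FU UE U0]] := symmetric_extension tauM tauS.
have Utau g s : d g != k.+1 -> size s = n -> U g s = 0.
  by move=> dg szs; rewrite UE // /tau (negPf dg).
(* The extension [T2] has served to define [F] and to show it closed; the correction is added to [T]
   itself. *)
pose T3 g s := 1 * U g s + T g s.
have [FT iT Tn Tfix Tk] := gT.
have FT3 : functional T3 by apply: functional_linear.
have tw3 x g s : twist x T3 g s = twist x U g s + twist x T g s.
  by rewrite /twist /T3; ring.
have T3n x : vanishes n (twist x T3).
  move=> g s szs; rewrite tw3 Tn // addr0 twist_lead //; last first.
    by move=> h s' szs'; apply: U0; lia.
  move: szs; rewrite leq_eqVlt => /predU1P[szs|szs]; last by apply: U0.
  rewrite UE // /tau; case: ifP => // _; rewrite big1 // => j _.
  have szs1 y : size (p g (e j) :: y :: s) = n.+1 by rewrite -szs.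
  have := @symmetric_front _ _ n.+1 (F g (f j)) [:: p g (e j)] s
    (x - kappa *: act g x) (FS g _) (szs1 _).
  by rewrite /= F0 // => ->; rewrite mulr0.
have T3fix g x s : kappa *: act g x = x -> (size s <= n)%N -> twist x T3 g s = 0.
  move=> gx szs; rewrite tw3 Tfix // addr0 twist_fixed0 // => h s' szs'.
  by apply: U0; lia.
have T3k g x s : (d g < k.+2)%N -> kappa *: act g x = x -> (size s <= n.+1)%N ->
    twist x T3 g s = 0.
  move=> dg gx; rewrite leq_eqVlt => /predU1P[szs|]; last exact: T3fix.
  have Uder : twist x U g s = picksum id (fun y s' => b 1%g x y * U g s') [::] s.
    apply: twist_derivation => // r y s' dr szs'; apply: Utau; first by lia.
    by lia.
  rewrite tw3 Uder.
  move: dg; rewrite ltnS leq_eqVlt => /predU1P[dg|dg]; last first.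
    rewrite Tk ?szs // addr0 -[RHS](picksum0 id [::] s).
    apply: (@eq_picksum _ _ n) => // y s' szs'.
    by rewrite Utau ?mulr0 // ltn_eqF.
  have -> : twist x T g s = twist x T2 g s.
    by apply: eq_twist_fixed => // h s' szs'; rewrite T2E //; lia.
  rewrite (@eq_picksum _ _ n _ _ (fun y s' => b 1%g x y * tau g s')) //; last first.
    by move=> y s' szs'; rewrite UE.
  by rewrite tauE // /F p_id // addNr.
have fixJ h g x : kappa *: act g x = x ->
    kappa *: act (g ^ h^-1)%g (act h x) = act h x.
  move=> gx; rewrite -{2}gx -actM conjgE invgK !mulgA mulgKV.
  have act0 := act0 actL h; have := actL h kappa (act g x) 0.
  by rewrite !addr0 act0 addr0 => ->; rewrite actM.
exists (average T3); first split.
- exact: average_functional.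
- exact: average_invariant.
- move=> x g s szs; apply: twist_average => h; apply: T3n.
  by rewrite size_map.
- move=> g x s gx szs; apply: twist_average => h; apply: T3fix.
    exact: fixJ.
  by rewrite size_map.
- move=> g x s dg gx szs; apply: twist_average => h; apply: T3k.
  + by rewrite dJ.
  + exact: fixJ.
  + by rewrite size_map.
move=> g s szs dgs; apply: average_id => h.
rewrite /T3 iT mul1r; case: ltnP (dgs) => [szs' _|szs' /= /eqP dg].
  by rewrite U0 ?add0r // size_map.
by rewrite Utau ?add0r ?dJ ?dg // size_map; apply/eqP; rewrite eqn_leq szs.
Qed.

(** Once k exceeds the maximum of [d], the fixed equations hold at every g in degree n + 1, and
    [perp_good] raises n. Meanwhile the degree n part may still change where d g > 0. *)
Lemma good_step n T : good n 0 T -> exists2 T', good n.+1 0 T' &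
  forall g s, (size s <= n)%N -> (size s < n)%N || (d g == 0)%N -> T' g s = T g s.
Proof.
move=> gT.
have [T1 gT1 T1E] : exists2 T1, good n (\max_g d g).+1 T1 &
  forall g s, (size s <= n)%N -> (size s < n)%N || (d g == 0)%N -> T1 g s = T g s.
  elim: (\max_g d g).+1 => [|k [T1 /fixed_step[T2 gT2 T2E] T1E]]; first by exists T.
  by exists T2 => // g s szs dgs; rewrite T2E ?T1E.
have [T2 [[FT2 iT2 _ _ T2k] T2E T2n _]] := perp_good gT1.
exists T2; last by move=> g s szs dgs; rewrite T2E ?T1E.
split=> // g x s gx szs; apply: T2k => //.
by rewrite ltnS; apply: (leq_bigmax_cond (F := d)).
Qed.

(** * Existence and uniqueness of twisted traces *)

Lemma twisted_trace_exists (c : G -> K) :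
  (forall g h, c (g ^ h)%g = c g) ->
  exists T, [/\ functional T, invariant_functional T,
    forall x g s, twist x T g s = 0 & forall g, d g = 0%N -> T g [::] = c g].
Proof.
move=> cJ.
have [T0 [FT0 T0E _]] : exists T, [/\ functional T,
    forall g s, size s = 0%N -> T g s = c g * (s == [::])%:R & vanishes 0 T].
  apply: (@symmetric_extension 0 (fun g s => c g * (s == [::])%:R)).
    by move=> g [|z u] v a x y /=; rewrite !mulr0 ?addr0.
  by move=> g [|z u] v x y.
have gT0 : good 0 0 (average T0).
  have FT := average_functional FT0.
  by split=> // [|g x s gx]; [exact: average_invariant
    |rewrite leqn0 => /nilP->; apply: twist_fixed0].
have [T1 gT1 T1E] := good_step gT0.
(* The shift by one is needed: step n may alter words of length n, which are settled only at stage n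
   + 1. The limit starts at stage 1 because the step from 0 keeps the prescribed values at d g =
   0. *)
have [||T TE1 TE] := @stable_limit (G * seq V) K (fun a => (size a.2).+1)
  (fun n (W : G * seq V -> K) => good n 0 (fun g s => W (g, s))) 1
  (fun a => T1 a.1 a.2); last 1 first.
- have agree m : exists2 T', good m.+1 0 T' &
      forall g s, (size s <= m)%N -> T (g, s) = T' g s.
    have [W gW WE] := TE m.+1 isT.
    by exists (fun g s => W (g, s)) => // g s szs; apply: WE.
  exists (fun g s => T (g, s)); split.
  + apply: functionalP => [g u v a x y|g u x y v].
      have [W [FW _ _ _ _] WE] := agree (size (u ++ x :: v)).
      by rewrite !WE ?FW.1 // !size_cat.
    have [W [FW _ _ _ _] WE] := agree (size (u ++ x :: y :: v)).
    rewrite WE // (WE g (u ++ y :: x :: v)); last by rewrite !size_cat.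
    rewrite (functional_swap g u x y v FW).
    congr (_ + _); apply: eq_bigr => r _; rewrite WE // !size_cat size_map /=.
    by lia.
  + move=> h g s; have [W [_ iW _ _ _] WE] := agree (size s).
    by rewrite !WE ?iW // size_map.
  + move=> x g s; have [W [_ _ W0 _ _] WE] := agree (size s).+1.
    rewrite -[RHS](W0 x g s) // /twist !WE // size_rcons //.
  + move=> g dg; rewrite (TE1 (g, [::])) //= T1E ?dg // (average_id (c := c g)) //.
    by move=> h; rewrite T0E // cJ mulr1.
- move=> m W /good_step[W' gW' W'E]; exists (fun a => W' a.1 a.2) => //.
  by move=> [g s] szs; rewrite /= W'E ?szs // ltnW.
- exact: gT1.
Qed.

(** Both equations used in degree n are at words of length n - 1 or n + 1, and commutators lower the
    degree by 2, so the two parities separate. The odd case serves to show that supertraces vanish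
    on odd words. *)
Lemma twisted_trace_unique q T : functional T ->
  (forall x g s, odd (size s) = ~~ q -> twist x T g s = 0) ->
  (forall g, q = false -> d g = 0%N -> T g [::] = 0) ->
  forall g s, odd (size s) = q -> T g s = 0.
Proof.
move=> FT T0 Td g s.
move: {2}(size s) (erefl (size s)) => n szs; elim/ltn_ind: n => n IHn in g s szs *.
move=> odd_s.
have TS h : symmetric_at n (T h).
  apply: functional_symmetric => // h' s' szs'.
  by apply: (IHn (size s')); rewrite // -?szs' // -odd_s szs -szs' /= negbK.
have Tp h x s' : (size s').+1 = n -> T h (p h x :: s') = T h (x :: s').
  move=> szs'; apply/esym/eqP; rewrite -subr_eq0 -(multilinearB [::] s' _ _ (FT.1 h)).
  rewrite /= -act_theta -twist_lead //.
    by apply/eqP/T0; rewrite -odd_s szs -szs' /= negbK.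
  move=> h' s'' szs''; apply: (IHn (size s'')); first by lia.
    by [].
  by rewrite -odd_s szs -szs' -szs'' /= negbK.
move: {2}(d g) (erefl (d g)) => k; elim/ltn_ind: k => k IHk in g s szs odd_s *.
move=> dg.
(* Euler's factor d g + n vanishes exactly at the free parameters: degree 0 and d g = 0. *)
have [k0|k0] := posnP (k + n).
  have s0 : s = [::] by apply/nilP; rewrite /nilp szs; lia.
  by rewrite s0 Td // ?dg; [rewrite -odd_s s0|lia].
have c0 : (d g + n)%:R != 0 :> K by rewrite dg -(prednK k0).
apply: (mulfI c0); rewrite mulr0 -(euler (n := n) (FT.1 g)) //; last exact: Tp.
rewrite big1 // => j _; rewrite -twist_derivation ?act_p //.
  by apply: T0; rewrite /= odd_s.
move=> r y s' dr [szs']; apply: (IHk (d (r * g)%g)) => //; first by rewrite -dg.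
  by rewrite szs'.
by rewrite -odd_s szs'.
Qed.

End TwistedTraces.

(** * Fixed spaces and reflections *)

Section FixedSpaces.
Variables (K : fieldType) (V : vectType K) (G : finGroupType).
Hypothesis charK : forall n, n.+1%:R != 0 :> K.
Variables (B : V -> V -> K) (rho : G -> 'End(V)).
Hypothesis BL : forall a x y z, B (a *: x + y) z = a * B x z + B y z.
Hypothesis BC : forall x y, B x y = - B y x.
Hypothesis Bnd : forall x, (forall y, B x y = 0) -> x = 0.
Hypothesis rho1 : forall x, rho 1%g x = x.
Hypothesis rhoM : forall g h x, rho (g * h)%g x = rho g (rho h x).
Hypothesis rhoB : forall g x y, B (rho g x) (rho g y) = B x y.
Implicit Types (x y z w : V) (g h r : G) (U W : {vspace V}) (k : nat).

Lemma formLr a x y z : B z (a *: x + y) = a * B z x + B z y.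
Proof. by rewrite BC BL opprD -mulrN -!BC. Qed.

Lemma form0 x : B 0 x = 0.
Proof. by have := BL (-1) 0 0 x; rewrite scaler0 addr0 mulN1r addNr. Qed.

Lemma form0r x : B x 0 = 0. Proof. by rewrite BC form0 oppr0. Qed.

Lemma formZ a x y : B (a *: x) y = a * B x y.
Proof. by rewrite -[a *: x]addr0 BL form0 addr0. Qed.

Lemma formZr a x y : B x (a *: y) = a * B x y.
Proof. by rewrite BC formZ -mulrN -BC. Qed.

Lemma formD x y z : B (x + y) z = B x z + B y z.
Proof. by rewrite -[x in LHS]scale1r BL mul1r. Qed.

Lemma formDr x y z : B z (x + y) = B z x + B z y.
Proof. by rewrite BC formD opprD -!BC. Qed.

Lemma formBl x y z : B (x - y) z = B x z - B y z.
Proof. by rewrite formD -scaleN1r formZ mulN1r. Qed.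

Lemma formBr x y z : B z (x - y) = B z x - B z y.
Proof. by rewrite formDr -scaleN1r formZr mulN1r. Qed.

Lemma formxx x : B x x = 0.
Proof.
have /eqP : B x x *+ 2 = 0 by rewrite mulr2n {2}BC subrr.
by rewrite -mulr_natl mulf_eq0 (negPf (charK 1)) => /eqP.
Qed.

Lemma form_suml (I : Type) (s : seq I) (P : pred I) (X : I -> V) y :
  B (\sum_(i <- s | P i) X i) y = \sum_(i <- s | P i) B (X i) y.
Proof.
by elim/big_rec2: _ => [|i a b _ <-]; [exact: form0|exact: formD].
Qed.

Lemma form_sumr (I : Type) (s : seq I) (P : pred I) (X : I -> V) y :
  B y (\sum_(i <- s | P i) X i) = \sum_(i <- s | P i) B y (X i).
Proof.
by elim/big_rec2: _ => [|i a b _ <-]; [exact: form0r|exact: formDr].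
Qed.

(** * The projection onto the fixed space of kappa g *)

Section Projection.
Variable kappa : K.
Hypothesis kappa2 : kappa * kappa = 1.

Definition kact g x := kappa *: rho g x.

Lemma kactB g x y : B (kact g x) (kact g y) = B x y.
Proof. by rewrite formZ formZr mulrA kappa2 mul1r rhoB. Qed.

Lemma kactJ g h x : kact (g ^ h^-1)%g (rho h x) = rho h (kact g x).
Proof.
by rewrite /kact linearZ /= -!rhoM conjgE invgK !mulgA mulgKV.
Qed.

(** A common period of all operators kappa g, since $\kappa^2 = 1$ and $g^{|G|} = 1$. *)
Definition kperiod := (#|G| * 2)%N.

Lemma kperiod_neq0 : kperiod%:R != 0 :> K.
Proof.
have : (0 < kperiod)%N by rewrite muln_gt0 -cardsT cardG_gt0.
by move/prednK <-.
Qed.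

Lemma iter_kact k g x : iter k (kact g) x = kappa ^+ k *: rho (g ^+ k)%g x.
Proof.
elim: k => [|k IH]; first by rewrite expr0 scale1r expg0 rho1.
by rewrite iterS IH /kact linearZ /= scalerA -rhoM -exprS -expgS.
Qed.

Lemma iter_kactL k g : linear (iter k (kact g)).
Proof. by move=> a x y; rewrite !iter_kact linearP scalerDr !scalerA mulrC. Qed.

Lemma iter_kperiod g x : iter kperiod (kact g) x = x.
Proof.
rewrite iter_kact /kperiod expgM mulnC exprM expr2 kappa2 expr1n scale1r.
have -> : (g ^+ #|G| = 1)%g.
  by apply/eqP; rewrite -order_dvdn -cardsT order_dvdG ?inE.
by rewrite expg1n rho1.
Qed.

Definition fixproj g x := kperiod%:R^-1 *: \sum_(k < kperiod) iter k (kact g) x.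

(** An average of geometric sums: 1 - kappa g sends the inner sum to x minus the k-th iterate, and
    averaging over a period gives x - [fixproj g x]. *)
Definition fixhom g x :=
  kperiod%:R^-1 *: \sum_(k < kperiod) \sum_(j < k) iter j (kact g) x.

Lemma kact_sum (I : Type) (s : seq I) (P : pred I) (X : I -> V) g :
  kact g (\sum_(i <- s | P i) X i) = \sum_(i <- s | P i) kact g (X i).
Proof. by rewrite /kact linear_sum scaler_sumr. Qed.

Lemma kactZ g a x : kact g (a *: x) = a *: kact g x.
Proof. by rewrite /kact linearZ scalerA mulrC -scalerA. Qed.

Lemma fixprojL g : linear (fixproj g).
Proof.
move=> a x y; rewrite /fixproj scalerA mulrC -scalerA -scalerDr; congr (_ *: _).
rewrite scaler_sumr -big_split; apply: eq_bigr => k _; exact: iter_kactL.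
Qed.

Lemma fixhomL g : linear (fixhom g).
Proof.
move=> a x y; rewrite /fixhom scalerA mulrC -scalerA -scalerDr; congr (_ *: _).
rewrite scaler_sumr -big_split; apply: eq_bigr => k _.
rewrite scaler_sumr -big_split; apply: eq_bigr => j _; exact: iter_kactL.
Qed.

Lemma kact_fixproj g x : kact g (fixproj g x) = fixproj g x.
Proof.
rewrite /fixproj kactZ kact_sum; congr (_ *: _).
transitivity (\sum_(k < kperiod) iter k.+1 (kact g) x); first by [].
have -> : kperiod = kperiod.-1.+1.
  by rewrite prednK // muln_gt0 -cardsT cardG_gt0.
rewrite big_ord_recr big_ord_recl /= addrC -iterS prednK ?iter_kperiod //.
by rewrite muln_gt0 -cardsT cardG_gt0.
Qed.

Lemma fixproj_id g x : kact g x = x -> fixproj g x = x.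
Proof.
move=> gx; have iterx k : iter k (kact g) x = x by elim: k => //= k ->.
rewrite /fixproj (eq_bigr _ (fun (k : 'I_kperiod) _ => iterx k)) sumr_const card_ord.
by rewrite -scaler_nat scalerA mulVf ?scale1r // kperiod_neq0.
Qed.

Lemma fixproj_sub g x y : fixproj g (x - y) = fixproj g x - fixproj g y.
Proof. by rewrite addrC -scaleN1r fixprojL scaleN1r addrC. Qed.

Lemma fixprojN g x : fixproj g (- x) = - fixproj g x.
Proof.
have f0 : fixproj g 0 = 0 by have := fixproj_sub g 0 0; rewrite !subrr.
by rewrite -[- x]add0r fixproj_sub f0 add0r.
Qed.

Lemma fixproj_im g x : fixproj g (x - kact g x) = 0.
Proof.
rewrite fixproj_sub; apply/eqP; rewrite subr_eq0; apply/eqP.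
rewrite -[LHS]kact_fixproj /fixproj kactZ kact_sum; congr (_ *: _).
by apply: eq_bigr => k _; rewrite -iterSr.
Qed.

Lemma iter_telescope g x k :
  (\sum_(j < k) iter j (kact g) x) - \sum_(j < k) iter j.+1 (kact g) x
  = x - iter k (kact g) x.
Proof.
elim: k => [|k IH]; first by rewrite !big_ord0 !subrr.
by rewrite !big_ord_recr /= opprD addrACA IH addrA subrK.
Qed.

Lemma sum_sub_iter g x :
  kperiod%:R^-1 *: \sum_(k < kperiod) (x - iter k (kact g) x) = x - fixproj g x.
Proof.
rewrite sumrB scalerBr sumr_const card_ord -scaler_nat scalerA mulVf ?scale1r //.
exact: kperiod_neq0.
Qed.

Lemma kact_fixhom g x : fixhom g x - kact g (fixhom g x) = x - fixproj g x.
Proof.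
rewrite -sum_sub_iter /fixhom kactZ -scalerBr kact_sum -sumrB.
congr (_ *: _); apply: eq_bigr => k _.
by rewrite kact_sum -iter_telescope.
Qed.

Lemma fixhom_im g x : fixhom g (x - kact g x) = x - fixproj g x.
Proof.
rewrite -kact_fixhom addrC -scaleN1r fixhomL scaleN1r addrC; congr (_ - _).
rewrite /fixhom kactZ kact_sum; congr (_ *: _); apply: eq_bigr => k _.
by rewrite kact_sum; apply: eq_bigr => j _; rewrite -iterSr.
Qed.

Lemma fixprojJ g h x : fixproj (g ^ h^-1)%g (rho h x) = rho h (fixproj g x).
Proof.
rewrite /fixproj [RHS]linearZ /=; congr (_ *: _); rewrite linear_sum.
apply: eq_bigr => k _.
by elim: (nat_of_ord k) => //= j ->; rewrite kactJ.
Qed.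

(** As kappa g preserves [B], its fixed space is orthogonal to the image of 1 - kappa g. *)
Lemma fixproj_adj g x y : B (fixproj g x) y = B x (fixproj g y).
Proof.
have H u v : B (fixproj g u) (v - fixproj g v) = 0.
  by rewrite -kact_fixhom formBr -{2}kact_fixproj kactB subrr.
have := H x y; rewrite formBr => /eqP; rewrite subr_eq0 => /eqP->.
have := H y x; rewrite formBr => /eqP; rewrite subr_eq0 => /eqP E.
by rewrite BC -E -BC.
Qed.

Definition kfix g : {vspace V} := lker (kappa *: rho g - \1)%VF.

Lemma kfixP g x : reflect (kact g x = x) (x \in kfix g).
Proof.
rewrite memv_ker add_lfunE scale_lfunE opp_lfunE id_lfunE subr_eq0.
exact: eqP.
Qed.

Definition kdim g := \dim (kfix g).

Lemma fixproj_mem g x : fixproj g x \in kfix g.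
Proof. by apply/kfixP/kact_fixproj. Qed.

Lemma kdim_eq0 g x : kdim g = 0%N -> fixproj g x = 0.
Proof.
move=> /eqP; rewrite dimv_eq0 => /eqP U0; apply/eqP; rewrite -memv0 -U0.
exact: fixproj_mem.
Qed.

Lemma rho_inj h : injective (rho h).
Proof. by move=> x y /(congr1 (rho h^-1%g)); rewrite -!rhoM mulVg !rho1. Qed.

Lemma kdimJ g h : kdim (g ^ h^-1)%g = kdim g.
Proof.
have le u r : (kdim u <= kdim (u ^ r^-1))%N.
  have -> : kdim u = \dim (rho r @: kfix u).
    rewrite limg_dim_eq //; apply/eqP; rewrite -subv0; apply/subvP => x.
    rewrite memv_cap memv_ker => /andP[_ /eqP]; rewrite -[RHS](linear0 (rho r)).
    by move/rho_inj->; rewrite mem0v.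
  apply: dimvS; apply/subvP => _ /memv_imgP[x /kfixP xu ->].
  by apply/kfixP; rewrite kactJ xu.
apply/eqP; rewrite eqn_leq le andbT; have := le (g ^ h^-1)%g h^-1%g.
by rewrite invgK conjgKV.
Qed.

Lemma kfix_coord g (U := kfix g) x : x \in U ->
  x = \sum_(i < \dim U) coord (vbasis U) i x *: (vbasis U)`_i.
Proof. exact: coord_vbasis. Qed.

(** The left side is the trace of the projection; when [fixproj g (e j)] is expanded in a basis of
    the image, each basis vector contributes 1. *)
Lemma fixproj_trace g (J : finType) (e f : J -> V) :
  (forall x, \sum_j B (f j) x *: e j = x) ->
  \sum_j B (fixproj g (f j)) (e j) = (kdim g)%:R.
Proof.
move=> fe; pose U := kfix g.
transitivity (\sum_j \sum_(i < \dim U)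
    B (f j) (vbasis U)`_i * coord (vbasis U) i (fixproj g (e j))).
  apply: eq_bigr => j _; rewrite fixproj_adj.
  rewrite {1}[fixproj g (e j)](kfix_coord (fixproj_mem g _)) form_sumr.
  by apply: eq_bigr => i _; rewrite formZr mulrC.
rewrite exchange_big /= /kdim -/U.
suff E (i : 'I_(\dim U)) : \sum_j B (f j) (vbasis U)`_i * coord (vbasis U) i (fixproj g (e j)) = 1.
  by rewrite (eq_bigr _ (fun i _ => E i)) sumr_const card_ord.
transitivity (coord (vbasis U) i (fixproj g (\sum_j B (f j) (vbasis U)`_i *: e j))).
  elim/big_rec2: _ => [|j y z _ ->]; last by rewrite fixprojL linearP.
  by have := fixprojL g (-1) 0 0; rewrite scaler0 addr0 scaleN1r addNr => ->; rewrite linear0.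
rewrite fe fixproj_id.
  by rewrite coord_free ?eqxx // (basis_free (vbasisP _)).
by apply/kfixP/vbasis_mem/mem_nth; rewrite size_tuple.
Qed.

End Projection.

Lemma dual_basis : exists e f : 'I_(\dim {:V}) -> V,
  (forall x, \sum_j B (f j) x *: e j = x) /\
  (forall x, \sum_j B x (e j) *: f j = x).
Proof.
pose e (j : 'I_(\dim {:V})) := (vbasis {:V})`_j.
have eE x : x = \sum_j coord (vbasis {:V}) j x *: e j.
  exact: coord_vbasis (memvf x).
pose Phi x := \sum_j B x (e j) *: e j.
have PhiL : linear Phi.
  move=> a x y; rewrite scaler_sumr -big_split; apply: eq_bigr => j _.
  by rewrite BL scalerDl scalerA.
pose P := linfun (HB.pack_for {linear V -> V} Phi (GRing.isLinear.Build _ _ _ _ Phi PhiL)).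
have PE x : P x = Phi x by rewrite lfunE.
have ef0 (a : 'I_(\dim {:V}) -> K) : \sum_j a j *: e j = 0 -> forall j, a j = 0.
  by move/freeP: (basis_free (vbasisP {:V})); apply.
have P0 : lker P == 0%VS.
  rewrite -subv0; apply/subvP => x; rewrite memv_ker PE => /eqP /ef0 x0.
  rewrite memv0; apply/eqP/Bnd => y; rewrite (eE y) form_sumr big1 // => j _.
  by rewrite formZr x0 mulr0.
(* Nondegeneracy makes [P] injective, hence invertible, and the preimages of the [e j] form the dual
   basis. *)
pose f j := (P^-1)%VF (e j).
have fe i j : B (f i) (e j) = (j == i)%:R.
  have : \sum_k (B (f i) (e k) - (k == i)%:R) *: e k = 0.
    have : Phi (f i) = e i by rewrite -PE (lker0_lfunVK P0).
    under eq_bigr => k _ do rewrite scalerBl.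
    rewrite sumrB /Phi => ->.
    rewrite (bigD1 i) //= eqxx scale1r big1 ?addr0 ?subrr // => k /negPf->.
    by rewrite scale0r.
  by move/ef0/(_ j)/eqP; rewrite subr_eq0 => /eqP.
have fE x : \sum_j B (f j) x *: e j = x.
  rewrite [RHS]eE; apply: eq_bigr => j _; congr (_ *: _).
  rewrite {1}[x]eE form_sumr (bigD1 j) //= formZr fe eqxx mulr1 big1 ?addr0 //.
  by move=> k kj; rewrite formZr fe (negPf kj) mulr0.
exists e, f; split=> // x.
apply/eqP; rewrite -subr_eq0; apply/eqP/Bnd => y.
rewrite formBl form_suml [in B x y](eE y) form_sumr -sumrB big1 // => j _.
rewrite formZ formZr [in B (f j) y](eE y) form_sumr.
rewrite (bigD1 j) //= formZr fe eqxx mulr1 big1 ?addr0 ?[B x _ * _]mulrC ?subrr //.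
by move=> k kj; rewrite formZr fe (negPf kj) mulr0.
Qed.

(** * Multiplication by a reflection lowers the fixed dimension *)

Section Reflections.
Variable kappa : K.
Hypothesis kappa2 : kappa * kappa = 1.
Variables (g r : G).
Let W := (kfix kappa g :&: kfix 1 r)%VS.

(** The product of [G] with a group of order 2 acting by kappa puts kappa g and r into one finite
    group of isometries. *)
Definition signed_act (t : G * bool) := (if t.2 then kappa else 1) *: rho t.1.
Local Notation sg := signed_act.
Definition pointwise_fixer : pred (G * bool) :=
  fun t => (W <= lker (sg t - \1)%VF)%VS.
Local Notation H := pointwise_fixer.

Lemma signed_actM s t x : sg (s.1 * t.1, s.2 (+) t.2)%g x = sg s (sg t x).
Proof.
rewrite /sg !scale_lfunE linearZ /= scalerA -rhoM; congr (_ *: _).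
by case: s.2; case: t.2; rewrite /= ?mul1r ?mulr1 ?kappa2.
Qed.

Lemma signed_actB t x y : B (sg t x) (sg t y) = B x y.
Proof.
rewrite /sg !scale_lfunE formZ formZr rhoB mulrA.
by case: t.2; rewrite ?kappa2 !mul1r.
Qed.

Lemma pointwise_fixerP t : reflect {in W, forall w, sg t w = w} (H t).
Proof.
apply: (iffP subvP) => [Ht w /Ht|Ht w /Ht E].
  by rewrite memv_ker add_lfunE opp_lfunE id_lfunE subr_eq0 => /eqP.
by rewrite memv_ker add_lfunE opp_lfunE id_lfunE E subrr.
Qed.

(** The projections onto the two fixed spaces need not commute. Averaging over the pointwise
    stabiliser of [W], which contains kappa g and r, gives a self-adjoint projection onto their
    intersection. *)
Definition fixer_average x := #|H|%:R^-1 *: \sum_(t in H) sg t x.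

Lemma card_fixer_neq0 : #|H|%:R != 0 :> K.
Proof.
have : (0 < #|H|)%N.
  apply/card_gt0P; exists (1%g, false); apply/pointwise_fixerP => w _.
  by rewrite /sg scale1r rho1.
by move/prednK <-.
Qed.

Lemma fixer_averageP s x : H s -> sg s (fixer_average x) = fixer_average x.
Proof.
move=> Hs; rewrite /fixer_average [LHS]linearZ linear_sum; congr (_ *: _).
pose m (t : G * bool) := (s.1 * t.1, s.2 (+) t.2)%g.
have m_inj : injective m by move=> [a b] [a' b'] [/mulgI-> /addbI->].
rewrite [RHS](reindex_inj m_inj) /=; apply: eq_big => [t|t _]; last first.
  by rewrite signed_actM.
apply/pointwise_fixerP/pointwise_fixerP => Ht w wW; rewrite ?signed_actM.
  by rewrite Ht //; move/pointwise_fixerP: Hs; apply.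
have := Ht w wW; rewrite signed_actM => E.
have /pointwise_fixerP/(_ w wW) Es := Hs.
have : sg s (sg t w) = sg s w by rewrite E Es.
have sg_inj : injective (sg s).
  move=> y z; rewrite /sg !scale_lfunE; case: s.2; rewrite ?scale1r.
    move/(congr1 (fun v => kappa *: v)); rewrite !scalerA kappa2 !scale1r.
    exact: rho_inj.
  exact: rho_inj.
exact: sg_inj.
Qed.

Lemma fixer_average_mem x : fixer_average x \in W.
Proof.
rewrite memv_cap; apply/andP; split; apply/kfixP.
  rewrite /kact -scale_lfunE; apply: (@fixer_averageP (g, true)).
  by apply/pointwise_fixerP => w; rewrite memv_cap /sg scale_lfunE => /andP[/kfixP].
rewrite /kact -scale_lfunE; apply: (@fixer_averageP (r, false)).
by apply/pointwise_fixerP => w; rewrite memv_cap /sg scale_lfunE => /andP[_ /kfixP].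
Qed.

Lemma fixer_average_id w : w \in W -> fixer_average w = w.
Proof.
move=> wW; rewrite /fixer_average (eq_bigr (fun=> w)).
  by rewrite sumr_const -scaler_nat scalerA mulVf ?scale1r // card_fixer_neq0.
by move=> t /pointwise_fixerP; apply.
Qed.

Lemma fixer_average_adj x y : B (fixer_average x) y = B x (fixer_average y).
Proof.
have E u v : B (fixer_average u) v = B (fixer_average u) (fixer_average v).
  rewrite {3}/fixer_average formZr form_sumr.
  rewrite (eq_bigr (fun=> B (fixer_average u) v)).
    by rewrite sumr_const -[_ *+ #|_|]mulr_natl mulKf // card_fixer_neq0.
  by move=> t Ht; rewrite -[in LHS](fixer_averageP u Ht) signed_actB.
by rewrite E BC -E -BC.
Qed.

Lemma dim_add_line U v : v \notin U -> (\dim U < \dim (U + <[v]>))%N.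
Proof.
move=> vU; rewrite (ltn_leqif (dimv_leqif_eq (addvSl _ _))).
by apply: contraNneq vU => ->; apply: (subvP (addvSr _ _)) (memv_line v).
Qed.

Hypothesis dim_r : \dim (limg (rho r - \1)%VF) = 2%N.
Variable x : V.
Hypothesis gx : kact kappa g x = x.
Hypothesis rx : rho r x != x.

(* The common fixed space is symplectic, hence of codimension at least 2. *)
Lemma dim_common_fix : (\dim W + 2 <= kdim kappa g)%N.
Proof.
pose q := fixer_average.
have qsub u v : q (u - v) = q u - q v.
  rewrite /q /fixer_average -scalerBr -sumrB; congr (_ *: _).
  by apply: eq_bigr => t _; rewrite linearB.
have qq u : q (u - q u) = 0.
  by rewrite qsub /q (fixer_average_id (fixer_average_mem u)) subrr.
have WK u : u \in W -> u \in kfix kappa g by case/memv_capP.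
have x_K : x \in kfix kappa g by apply/kfixP.
(* [x1] and the later [y2] are fixed by kappa g and orthogonal to [W], and they pair nontrivially;
   so they add two dimensions to [W]. *)
pose x1 := x - q x.
have x1_K : x1 \in kfix kappa g by rewrite memvB // WK ?fixer_average_mem.
have x1_neq0 : x1 != 0.
  apply: contraNneq rx => /eqP; rewrite subr_eq0 => /eqP xq.
  have /memv_capP[_ /kfixP] := fixer_average_mem x.
  by rewrite -/(q x) -xq /kact scale1r => ->.
have [y x1y] : exists y, B x1 y != 0.
  apply: contrapT => nex; move/eqP: x1_neq0; apply; apply: Bnd => y.
  by apply: contrapT => /eqP By; apply: nex; exists y.
pose y1 := fixproj kappa g y; pose y2 := y1 - q y1.
have x1y2 : B x1 y2 != 0.
  rewrite formBr -fixer_average_adj -/(q x1) qq form0 subr0 -fixproj_adj //.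
  by rewrite fixproj_id //; apply/kfixP.
have y2_K : y2 \in kfix kappa g.
  by rewrite memvB ?fixproj_mem // WK ?fixer_average_mem.
have x1_W : x1 \notin W.
  by apply: contra_neqN x1_neq0 => /fixer_average_id <-; apply: qq.
have y2_W : y2 \notin (W + <[x1]>)%VS.
  apply: contra_neqN x1y2 => /memv_addP[w wW [_ /vlineP[a ->] ->]].
  rewrite formDr formZr formxx mulr0 addr0 -(fixer_average_id wW).
  by rewrite -fixer_average_adj -/(q x1) qq form0.
have := dim_add_line x1_W; have := dim_add_line y2_W.
have : (\dim (W + <[x1]> + <[y2]>) <= kdim kappa g)%N.
  by apply: dimvS; rewrite !subv_add capvSl -!memvE x1_K y2_K.
by lia.
Qed.

(** On the fixed space K' of kappa r g, the map $r^{-1} - 1$ equals kappa g - 1, so its image lies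
    in the plane Im (r - 1) and is orthogonal to the fixed vector x. As r moves x, x is not
    orthogonal to the whole plane, so the image has dimension at most 1. The kernel in K' lies in
    [W], whence dim K' is at most dim W + 1. *)
Lemma reflection_kdim : (kdim kappa (r * g)%g < kdim kappa g)%N.
Proof.
pose f : 'End(V) := (rho r^-1%g - \1)%VF; pose K' := kfix kappa (r * g)%g.
have fE v : f v = rho r^-1%g v - v by rewrite /f add_lfunE opp_lfunE id_lfunE.
have rg v : v \in K' -> rho r^-1%g v = kact kappa g v.
  move=> /kfixP E; rewrite -[in LHS]E /kact linearZ /= -rhoM.
  by rewrite mulgA mulVg mul1g.
have fK' v : v \in K' -> B x (f v) = 0.
  by move=> vK; rewrite fE rg // formBr -[in B x (kact _ _ _)]gx kactB // subrr.
have imf : (f @: K' <= limg (rho r - \1)%VF)%VS.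
  apply/subvP => _ /memv_imgP[v vK ->].
  apply/memv_imgP; exists (- rho r^-1%g v); first exact: memvf.
  rewrite add_lfunE opp_lfunE id_lfunE linearN /= -rhoM mulgV rho1 fE opprK.
  by rewrite addrC.
have dim_im : (\dim (f @: K') < 2)%N.
  rewrite -dim_r (ltn_leqif (dimv_leqif_eq imf)).
  apply: contraNneq rx => imE.
  have Bim v : B x (rho r v - v) = 0.
    have : (rho r - \1)%VF v \in (f @: K')%VS by rewrite imE memv_img ?memvf.
    by case/memv_imgP => u uK; rewrite add_lfunE opp_lfunE id_lfunE => ->; apply: fK'.
  rewrite -subr_eq0; apply/eqP/Bnd => v; rewrite -[v]rho1 -(mulgV r) rhoM.
  set u := rho r^-1%g v; rewrite formBl rhoB; have := Bim u.
  by rewrite formBr => /eqP; rewrite subr_eq0 => /eqP->; rewrite subrr.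
have kerW : (K' :&: lker f <= W)%VS.
  apply/subvP => v /memv_capP[vK]; rewrite memv_ker fE subr_eq0 => /eqP vr.
  have rv : rho r v = v by rewrite -{1}vr -rhoM mulgV rho1.
  by rewrite memv_cap; apply/andP; split; apply/kfixP;
    [rewrite -rg|rewrite /kact scale1r].
have := limg_ker_dim f K'; have := dimvS kerW; have := dim_common_fix.
by rewrite /kdim -/K'; lia.
Qed.

End Reflections.

Local Notation pr r :=
  (daddv_pi (limg (rho r - \1)%VF) (lker (rho r - \1)%VF)).

Lemma reflection_projE r x : pr r x = x - fixproj 1 r x.
Proof.
have one2 : 1 * 1 = 1 :> K by rewrite mulr1.
have kerP v : v \in lker (rho r - \1)%VF -> kact 1 r v = v.
  by rewrite memv_ker add_lfunE opp_lfunE id_lfunE subr_eq0 /kact scale1r => /eqP.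
have imP v : (rho r - \1)%VF v = kact 1 r v - v.
  by rewrite add_lfunE opp_lfunE id_lfunE /kact scale1r.
have cap0 : (limg (rho r - \1)%VF :&: lker (rho r - \1)%VF = 0)%VS.
  apply/eqP; rewrite -subv0; apply/subvP => v /memv_capP[/memv_imgP[u _ ->]].
  move/kerP/fixproj_id; rewrite imP -opprB => <-.
  by rewrite fixprojN fixproj_im // oppr0 mem0v.
set U := limg _ in cap0 *; set Z := lker _ in cap0 *.
have xU : x - fixproj 1 r x \in U.
  rewrite -kact_fixhom // -opprB memvN -imP; apply: memv_img; exact: memvf.
have pZ : fixproj 1 r x \in Z.
  by rewrite memv_ker imP kact_fixproj // subrr.
rewrite -{1}[x](subrK (fixproj 1 r x)) linearD /= daddv_pi_id //.
have := daddv_pi_add cap0 (w := fixproj 1 r x).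
rewrite (daddv_pi_id (U := Z)) ?(capvC Z) // => /(_ (subvP (addvSr _ _) _ pZ)).
by move=> /(canRL (addrK _)); rewrite subrr => ->; rewrite addr0.
Qed.

(** The left side is alternating and trilinear on a plane; the proof checks its vanishing in
    coordinates. *)
Lemma plane_jacobi U x y z : \dim U = 2%N -> x \in U -> y \in U -> z \in U ->
  B x y *: z + B y z *: x + B z x *: y = 0.
Proof.
move=> dimU.
have [a [c ac]] : exists a c, forall v, v \in U -> exists s t, v = s *: a + t *: c.
  exists (vbasis U)`_0, (vbasis U)`_1 => v /coord_vbasis ->.
  have E (F : nat -> V) : \sum_(i < \dim U) F i = F 0%N + F 1%N.
    by rewrite dimU big_ord_recl big_ord1.
  pose F (n : nat) := if insub n is Some i then coord (vbasis U) i v else 0.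
  exists (F 0%N), (F 1%N); rewrite -(E (fun n => F n *: (vbasis U)`_n)).
  by apply: eq_bigr => i _; rewrite /F valK.
move=> /ac[x1 [x2 ->]] /ac[y1 [y2 ->]] /ac[z1 [z2 ->]].
rewrite !BL !formZ !formLr !formZr !formxx (BC c a).
rewrite !scalerDr !scalerA.
set p := B a c.
transitivity ((x1 * y2 * p - x2 * y1 * p) *: (z1 *: a + z2 *: c)
  + (y1 * z2 * p - y2 * z1 * p) *: (x1 *: a + x2 *: c)
  + (z1 * x2 * p - z2 * x1 * p) *: (y1 *: a + y2 *: c)).
  by rewrite !scalerDr !scalerA; do ![congr (_ + _)]; congr (_ *: _); ring.
rewrite !scalerDr !scalerA.
have E3 (a1 b1 a2 b2 a3 b3 : V) :
    a1 + b1 + (a2 + b2) + (a3 + b3) = a1 + a2 + a3 + (b1 + b2 + b3).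
  by rewrite (addrACA a1) (addrACA (a1 + a2)).
rewrite E3 -!scalerDl.
rewrite [X in X *: a](_ : _ = 0) ?scale0r ?add0r; last by ring.
by rewrite [X in X *: c](_ : _ = 0) ?scale0r //; ring.
Qed.

(** Since r v - v depends only on the component of v in the plane Im (r - 1), the sum is the image
    under r - 1 of the identity in that plane. *)
Lemma reflection_jacobi r x y z : \dim (limg (rho r - \1)%VF) = 2%N ->
  B (pr r x) (pr r y) *: (rho r z - z) + B (pr r y) (pr r z) *: (rho r x - x)
  + B (pr r z) (pr r x) *: (rho r y - y) = 0.
Proof.
move=> dim2.
have E v : rho r v - v = (rho r - \1)%VF (pr r v).
  rewrite reflection_projE add_lfunE opp_lfunE id_lfunE linearB /=.
  have := kact_fixproj (mulr1 1) r v.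
  by rewrite {1}/kact scale1r => ->; rewrite opprB addrA addrNK.
have fZ a v : a *: (rho r - \1)%VF v = (rho r - \1)%VF (a *: v) by rewrite linearZ.
have fD u v : (rho r - \1)%VF u + (rho r - \1)%VF v = (rho r - \1)%VF (u + v).
  by rewrite linearD.
by rewrite !E !fZ !fD (plane_jacobi dim2) ?memv_pi // linear0.
Qed.

Lemma reflection_formJ r h x y :
  B (pr (r ^ h^-1)%g (rho h x)) (pr (r ^ h^-1)%g (rho h y))
  = B (pr r x) (pr r y).
Proof. by rewrite !reflection_projE !fixprojJ // -!linearB /= rhoB. Qed.

Lemma reflection_form0 r x y : rho r x = x -> B (pr r x) y = 0.
Proof.
move=> rx; rewrite reflection_projE fixproj_id ?subrr ?form0 //.
by rewrite /kact scale1r.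
Qed.

Lemma dim_reflectionJ r h :
  \dim (limg (rho (r ^ h^-1)%g - \1)%VF) = \dim (limg (rho r - \1)%VF).
Proof.
pose n u := \dim (limg (rho u - \1)%VF).
have le u t : (n u <= n (u ^ t^-1)%g)%N.
  rewrite /n -(@limg_dim_eq _ _ _ (rho t) (limg (rho u - \1)%VF)).
    apply: dimvS; apply/subvP => _ /memv_imgP[_ /memv_imgP[v _ ->] ->].
    apply/memv_imgP; exists (rho t v); first exact: memvf.
    rewrite !add_lfunE !opp_lfunE !id_lfunE linearB /= -!rhoM.
    by rewrite conjgE invgK !mulgA mulgKV.
  apply/eqP; rewrite -subv0; apply/subvP => v; rewrite memv_cap memv_ker => /andP[_ /eqP].
  by rewrite -[RHS](linear0 (rho t)) => /rho_inj->; rewrite mem0v.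
apply/eqP; rewrite -/(n _) -/(n r) eqn_leq le andbT; have := le (r ^ h^-1)%g h^-1%g.
by rewrite invgK conjgKV.
Qed.

End FixedSpaces.

(** * Traces on the symplectic reflection algebra *)

(* Kept abstract for the same reason as [SpanningMonoid]. *)
Section Words.
Variables (K : fieldType) (V : lmodType K) (G : finGroupType).
Variables (act : G -> V -> V) (b : G -> V -> V -> K).
Hypothesis act1 : forall x, act 1%g x = x.
Variables (A : pzRingType) (sc : K -> A -> A) (vec : V -> A) (grp : G -> A).
Hypothesis scAl : forall c (a a' : A), sc c (a * a') = sc c a * a'.
Hypothesis scAr : forall c (a a' : A), sc c (a * a') = a * sc c a'.
Hypothesis vecL : forall a x y, vec (a *: x + y) = sc a (vec x) + vec y.
Hypothesis grpM : forall g h, grp (g * h)%g = grp g * grp h.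
Hypothesis cross : forall g x, grp g * vec x = vec (act g x) * grp g.
Hypothesis vec_comm : forall x y,
  vec x * vec y - vec y * vec x = \sum_r sc (b r x y) (grp r).
Implicit Types (s u v w : seq V) (x y z : V) (g h r : G).

Definition word s g : A := \prod_(x <- s) vec x * grp g.

Lemma word_nil g : word [::] g = grp g.
Proof. by rewrite /word big_nil mul1r. Qed.

Lemma word_cons x s g : word (x :: s) g = vec x * word s g.
Proof. by rewrite /word big_cons mulrA. Qed.

Lemma word_cat u v g : word (u ++ v) g = \prod_(x <- u) vec x * word v g.
Proof. by rewrite /word big_cat mulrA. Qed.

Lemma word_grp s g h : word s g * grp h = word s (g * h)%g.
Proof. by rewrite /word -mulrA grpM. Qed.

Lemma word_vec s g x : word s g * vec x = word (rcons s (act g x)) g.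
Proof.
by rewrite -cats1 word_cat word_cons word_nil /word -mulrA cross.
Qed.

Lemma grp_word h s g : grp h * word s g = word (map (act h) s) (h * g)%g.
Proof.
elim: s => [|x s IH]; first by rewrite /word /= !big_nil !mul1r grpM.
by rewrite /= !word_cons mulrA cross -mulrA IH.
Qed.

Lemma word_functional (t : A -> K) :
  (forall a a', t (a + a') = t a + t a') -> (forall c a, t (sc c a) = c * t a) ->
  functional act b (fun g s => t (word s g)).
Proof.
move=> tD tZ; apply: functionalP => [g u v a x y|g u x y v].
  by rewrite !word_cat !word_cons vecL mulrDl mulrDr -scAl -scAr tD tZ.
rewrite !word_cat !word_cons.
have -> : vec x * (vec y * word v g)
    = vec y * (vec x * word v g) + \sum_r sc (b r x y) (grp r) * word v g.
  by rewrite -mulr_suml -vec_comm mulrBl !mulrA addrC subrK.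
rewrite mulrDr tD; congr (_ + _).
have t0 : t 0 = 0 by apply: (addrI (t 0)); rewrite -tD !addr0.
have t_sum (F : G -> A) : t (\sum_r F r) = \sum_r t (F r).
  by elim/big_rec2: _ => [//|r c a _ <-]; rewrite tD.
rewrite mulr_sumr t_sum; apply: eq_bigr => r _.
by rewrite -scAl -scAr tZ grp_word word_cat.
Qed.

Lemma twisted_commutator_linear (t : A -> K) (m : A) k c a a' :
  (forall a a', t (a + a') = t a + t a') -> (forall c a, t (sc c a) = c * t a) ->
  t (m * (sc c a + a')) - k * t ((sc c a + a') * m) =
  c * (t (m * a) - k * t (a * m)) + (t (m * a') - k * t (a' * m)).
Proof.
by move=> tD tZ; rewrite mulrDr mulrDl -scAr -scAl !tD !tZ; ring.
Qed.

Section SignedCommutation.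
Variable t : A -> K.
Hypothesis tD : forall a a', t (a + a') = t a + t a'.
Hypothesis tZ : forall c a, t (sc c a) = c * t a.

Lemma signed_comm0 k m : t (0 * m) = k * t (m * 0).
Proof.
have t0 : t 0 = 0 by apply: (addrI (t 0)); rewrite -tD !addr0.
by rewrite mul0r mulr0 t0 mulr0.
Qed.

Lemma signed_commD a a' k : (forall m, t (a * m) = k * t (m * a)) ->
  (forall m, t (a' * m) = k * t (m * a')) ->
  forall m, t ((a + a') * m) = k * t (m * (a + a')).
Proof. by move=> Ha Ha' m; rewrite mulrDl mulrDr !tD Ha Ha' mulrDr. Qed.

Lemma signed_commZ a c k : (forall m, t (a * m) = k * t (m * a)) ->
  forall m, t (sc c a * m) = k * t (m * sc c a).
Proof. by move=> Ha m; rewrite -scAl -scAr !tZ Ha mulrCA. Qed.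

Lemma signed_commM a a' k k' : (forall m, t (a * m) = k * t (m * a)) ->
  (forall m, t (a' * m) = k' * t (m * a')) ->
  forall m, t (a * a' * m) = k * k' * t (m * (a * a')).
Proof. by move=> Ha Ha' m; rewrite -mulrA Ha -mulrA Ha' -(mulrA m) mulrA. Qed.

Lemma signed_comm_word k :
  (forall x m, t (vec x * m) = k * t (m * vec x)) ->
  (forall g m, t (grp g * m) = t (m * grp g)) ->
  forall s g m, t (word s g * m) = k ^+ size s * t (m * word s g).
Proof.
move=> Hv Hg; elim=> [|x s IH] g m; first by rewrite word_nil expr0 mul1r Hg.
by rewrite word_cons exprS; apply: signed_commM.
Qed.

End SignedCommutation.

End Words.

Section FreeNormalForm.
Variables (V : Type) (G : finGroupType) (act : G -> V -> V).
Hypothesis act1 : forall x, act 1%g x = x.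
Hypothesis actM : forall g h x, act (g * h)%g x = act g (act h x).

Definition normal_cons (i : V + G) (p : seq V * G) : seq V * G :=
  match i with
  | inl x => (x :: p.1, p.2)
  | inr g => (map (act g) p.1, (g * p.2)%g)
  end.

(** Group letters move to the right by the crossing relation alone; the order of the vectors is
    kept. *)
Definition normal_form (m : seq (V + G)) := foldr normal_cons ([::], 1%g) m.

Lemma normal_form_cat m n : normal_form (m ++ n) =
  ((normal_form m).1 ++ map (act (normal_form m).2) (normal_form n).1,
   ((normal_form m).2 * (normal_form n).2)%g).
Proof.
elim: m => [|[x|g] m IH] /=.
- case: (normal_form n) => s g; rewrite mul1g; congr (_, _).
  by rewrite -[LHS]map_id; apply: eq_map => x; rewrite act1.
- by rewrite -/(normal_form _) IH.
- rewrite -/(normal_form _) IH /= map_cat mulgA -map_comp; congr (_ ++ _, _).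
  by apply: eq_map => x /=; rewrite actM.
Qed.

End FreeNormalForm.

Section SraWords.
Variables (K : fieldType) (V : vectType K) (omega : {skew_symmetric V}).
Variables (G : finGroupType) (rho : G -> 'End(V)) (eta : G -> K).
Local Notation A := (pres_alg (sra_rel omega rho eta)).
Local Notation vec := (sra_vec omega rho eta).
Local Notation grp := (sra_grp omega rho eta).
Implicit Types (s u v w : seq V) (x y z : V) (g h r : G).

(* The coefficient of r in [x, y]; omega is the coefficient of 1. *)
Definition sra_bracket r x y : K :=
  (omega x y) *+ (r == 1%g)
  + (eta r * omega_refl omega rho r x y) *+ (r \in sp_reflections rho).

Lemma sra_vecL a x y : vec (a *: x + y) = a *: vec x + vec y.
Proof.
apply/eqP; rewrite -subr_eq0 /sra_vec /pres_gen -pres_piZ -raddfD -raddfB.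
by apply/eqP/pres_pi_rel/SraLin.
Qed.

Lemma sra_grp1 : grp 1%g = 1.
Proof.
apply/eqP; rewrite -subr_eq0 (_ : 1 = pres_pi _ 1) // -raddfB.
by apply/eqP/pres_pi_rel/SraGrp1.
Qed.

Lemma sra_grpM g h : grp (g * h)%g = grp g * grp h.
Proof.
apply/eqP; rewrite -subr_eq0 /sra_grp /pres_gen -pres_piM -raddfB.
by apply/eqP/pres_pi_rel/SraGrpM.
Qed.

Lemma sra_cross g x : grp g * vec x = vec (rho g x) * grp g.
Proof.
apply/eqP; rewrite -subr_eq0 /sra_grp /sra_vec /pres_gen -!pres_piM -raddfB.
by apply/eqP/pres_pi_rel/SraCross.
Qed.

Lemma sra_comm x y :
  vec x * vec y - vec y * vec x = \sum_r sra_bracket r x y *: grp r.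
Proof.
pose refl_part : A := \sum_(r in sp_reflections rho)
  (eta r * omega_refl omega rho r x y) *: grp r.
transitivity (omega x y *: (1 : A) + refl_part); rewrite {}/refl_part.
  apply/eqP; rewrite -subr_eq0 /sra_grp /sra_vec /pres_gen.
  under eq_bigr => r _ do rewrite -pres_piZ.
  rewrite (_ : 1 = pres_pi _ 1) // -pres_piZ -!pres_piM -raddf_sum.
  rewrite -raddfD -!raddfB.
  by apply/eqP/pres_pi_rel/SraComm.
rewrite -sra_grp1 /sra_bracket.
under [RHS]eq_bigr => r _ do rewrite scalerDl.
rewrite big_split /=; congr (_ + _).
  rewrite (bigD1 1%g) //= eqxx mulr1n big1 ?addr0 // => r /negPf->.
  by rewrite mulr0n scale0r.
rewrite big_mkcond; apply: eq_bigr => r _.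
by case: ifP => _; rewrite ?mulr1n // mulr0n scale0r.
Qed.

Local Notation X := (V + G)%type.
Local Notation act := (fun g : G => rho g : V -> V).
Local Notation wd := (word vec grp).
Hypothesis rho1 : forall x, rho 1%g x = x.
Hypothesis rhoM : forall g h x, rho (g * h)%g x = rho g (rho h x).
Hypothesis bracketJ : forall g h x y,
  sra_bracket (g ^ h^-1)%g (rho h x) (rho h y) = sra_bracket g x y.

Lemma sra_monomE (m : {fmonom X}) : pres_pi _ << m >> =
  wd (normal_form act m).1 (normal_form act m).2.
Proof.
case: m => m; elim: m => [|i m IH].
  by rewrite word_nil sra_grp1 -fmoneE.
have -> : FMonom (i :: m) = mmul (fmu i) (FMonom m).
  by rewrite [mmul _ _]fmmulE fmU.
rewrite -malg_mulU1 pres_piM {}IH.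
have -> : normal_form act (mmul (fmu i) (FMonom m)) =
    normal_cons act i (normal_form act m) by rewrite [mmul _ _]fmmulE fmU.
case: i => [x|g] /=; first by rewrite word_cons.
exact: (grp_word sra_grpM sra_cross).
Qed.

Lemma normal_form_word s g :
  normal_form act (map inl s ++ [:: inr g]) = (s, g).
Proof.
elim: s => [|x s IH] /=; first by rewrite mulg1.
by rewrite -/(normal_form _ _) IH.
Qed.

(** The functional on the free algebra evaluates [T] at normal forms. Between two monomials, the
    commutator relation becomes the swap relation of [T], and the other relations already hold for
    normal forms or by multilinearity. *)
Lemma sra_functional (T : G -> seq V -> K) : functional act sra_bracket T ->
  exists t : {linear A -> K^o}, forall s g, t (wd s g) = T g s.
Proof.
move=> FT; pose N := normal_form act.
pose h (m : {fmonom X}) := T (N m).2 (N m).1.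
have NE (m n : {fmonom X}) : N (mmul m n) =
    ((N m).1 ++ map (act (N m).2) (N n).1, ((N m).2 * (N n).2)%g).
  have -> : (mmul m n : seq X) = m ++ n by rewrite [mmul m n]fmmulE.
  exact: normal_form_cat.
have [l [lD lZ lU]] := malg_functional h.
have [f m n relf|t tE] := pres_functional (rel := sra_rel omega rho eta) lD lZ.
  pose L f := l (<< m >> * f * << n >>).
  have LD f1 f2 : L (f1 + f2) = L f1 + L f2.
    by rewrite /L (mulrDr _ f1) (mulrDl (_ * _)) lD.
  have LZ c f1 : L (c *: f1) = c * L f1.
    by rewrite /L -malg_scaleAr -scalerAl lZ.
  have LU q : L << q >> = h (mmul (mmul m q) n).
    by rewrite /L !malg_mulU1 lU.
  have LB f1 f2 : L (f1 - f2) = L f1 - L f2.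
    by rewrite -scaleN1r LD LZ mulN1r.
  have L0 : L 0 = 0 by rewrite -(scale0r 0) LZ mul0r.
  have Lsum (F : G -> {malg K[{fmonom X}]}) (P : pred G) :
      L (\sum_(r | P r) F r) = \sum_(r | P r) L (F r).
    by elim/big_rec2: _ => [//|r c f1 _ <-]; rewrite LD.
  pose p := N m; pose q := N n.
  have LQ (Q : {fmonom X}) (u : seq V) (k : G) : N Q = (u, k) -> L << Q >> =
      T (p.2 * k * q.2)%g (p.1 ++ map (act p.2) u ++ map (act (p.2 * k)%g) q.1).
    by move=> NQ; rewrite LU /h !NE NQ /= -catA.
  have N1 : N (mone : {fmonom X}) = ([::], 1%g) by rewrite fm1.
  have Nv x : N (fmu (inl x : X)) = ([:: x], 1%g) by rewrite fmU.
  have Ng g : N (fmu (inr g : X)) = ([::], g) by rewrite fmU /N /= mulg1.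
  have act1 : map (act (p.2 * 1)%g) q.1 = map (act p.2) q.1 by rewrite mulg1.
  rewrite -/(L f); case: relf => [a x y||g g'|g x|x y].
  - rewrite LB LD LZ /free_gen !(LQ _ _ _ (Nv _)) /= linearP FT.1; ring.
  - by rewrite LB /free_gen (LQ _ _ _ (Ng _)) /= (LQ _ _ _ N1) mulg1 subrr.
  - rewrite LB /free_gen malg_mulU1 (LQ _ _ _ (Ng _)) /=.
    by rewrite (LQ _ [::] (g * g')%g) ?NE ?Nv ?Ng /= ?mulg1 // subrr.
  - rewrite LB /free_gen !malg_mulU1.
    rewrite (LQ _ [:: rho g x] g) ?NE ?Nv ?Ng /= ?mulg1 //.
    by rewrite (LQ _ [:: rho g x] g) ?NE ?Nv ?Ng /= ?mulg1 ?mul1g // subrr.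
  have Lxy x' y' : L (free_gen K (inl x') * free_gen K (inl y')) =
      T (p.2 * q.2)%g (p.1 ++ rho p.2 x' :: rho p.2 y' :: map (act p.2) q.1).
    rewrite /free_gen malg_mulU1 (LQ _ [:: x'; y'] 1%g) ?NE ?Nv ?Ng /= ?mulg1 //.
    by rewrite rho1.
  have swap := functional_swap (p.2 * q.2)%g p.1 (rho p.2 x) (rho p.2 y)
    (map (act p.2) q.1) FT.
  have {}swap := canLR (addrK _) (etrans swap (addrC _ _)).
  have Lcomm := etrans (etrans (LB _ _)
    (congr2 (fun c c' => c - c') (Lxy x y) (Lxy y x))) swap.
  rewrite LB [X in _ - X]LD LZ Lsum; apply/eqP; rewrite subr_eq0; apply/eqP.
  apply: (etrans Lcomm) => {Lcomm}.
  have -> : L 1 = L (free_gen K (inr 1%g)).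
    by rewrite /free_gen (LQ _ _ _ (Ng _)) /= (LQ _ _ _ N1) mulg1.
  transitivity (\sum_r sra_bracket r x y * L (free_gen K (inr r))).
    (* The group part of the left monomial acts on x and y; [bracketJ] turns this into a conjugation
       of r. *)
    rewrite /bracket_term (reindex_inj (conjg_inj p.2^-1%g)) /=.
    apply: eq_bigr => r _; rewrite bracketJ /free_gen (LQ _ _ _ (Ng _)) /=.
    rewrite -map_comp; congr (_ * T _ (_ ++ _)).
      by rewrite conjgE invgK !mulgA mulgKV.
    by apply: eq_map => z /=; rewrite -rhoM conjgE invgK !mulgA mulgKV.
  rewrite /sra_bracket; under eq_bigr => r _ do rewrite mulrDl.
  rewrite big_split /=; congr (_ + _).
    rewrite (bigD1 1%g) //= eqxx mulr1n big1 ?addr0 // => r /negPf->.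
    by rewrite mulr0n mul0r.
  rewrite [RHS]big_mkcond; apply: eq_bigr => r _.
  by case: ifP => _; rewrite ?mulr0n ?mul0r // mulr1n LZ.
exists t => s g; have := sra_monomE (FMonom (map inl s ++ [:: inr g])).
by rewrite normal_form_word /= => <-; rewrite tE lU /h /N normal_form_word.
Qed.

Lemma sra_word_span (t : A -> K^o) : linear t ->
  (forall s g, t (wd s g) = 0) -> forall a, t a = 0.
Proof.
move=> tL t0 a; rewrite -(pres_reprK a); move: (pres_repr a).
apply: malg_span => [|f f' tf tf'|c m].
- by have := tL (-1) 0 0; rewrite scaler0 addr0 scaleN1r addNr raddf0.
- by rewrite raddfD /= -[X in t (X + _)]scale1r tL tf tf' scaler0 addr0.
have := tL c (pres_pi _ << m >>) 0; rewrite addr0 -pres_piZ => ->.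
rewrite sra_monomE t0 scaler0 add0r.
by have := tL (-1) 0 0; rewrite scaler0 addr0 scaleN1r addNr.
Qed.

End SraWords.

Section SraTraces.
Variables (K : fieldType) (V : vectType K) (omega : {skew_symmetric V}).
Hypothesis charK : forall n, n.+1%:R != 0 :> K.
Hypothesis omega_nd : nondegenerate omega.
Variables (G : finGroupType) (rho : G -> 'End(V)).
Hypothesis rho_sp : sp_subgroup omega rho.
Variable eta : G -> K.
Hypothesis etaJ : forall r g : G, r \in sp_reflections rho ->
  eta (r ^ g)%g = eta r.
Local Notation A := (pres_alg (sra_rel omega rho eta)).
Local Notation vec := (sra_vec omega rho eta).
Local Notation grp := (sra_grp omega rho eta).
Local Notation wd := (word vec grp).
Local Notation br := (sra_bracket omega rho eta).
Local Notation act := (fun g : G => rho g : V -> V).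
Implicit Types (s u v w : seq V) (x y z : V) (g h r : G).

Lemma omegaL a x y z : omega (a *: x + y) z = a * omega x z + omega y z.
Proof. by rewrite linearDl linearZl_LR. Qed.

Lemma omegaC x y : omega x y = - omega y x.
Proof. by rewrite [LHS]hermC expr1 mulN1r. Qed.

Lemma omega_nondeg x : (forall y, omega x y = 0) -> x = 0.
Proof.
move=> x0; apply/eqP; rewrite -memv0 -(eqP omega_nd).
by apply/mem_orthovP => y _.
Qed.

Lemma rho1E x : rho 1%g x = x.
Proof. by have [_ -> _ _] := rho_sp; rewrite id_lfunE. Qed.

Lemma rhoME g h x : rho (g * h)%g x = rho g (rho h x).
Proof. by have [_ _ -> _] := rho_sp; rewrite comp_lfunE. Qed.

Lemma rho_omega g x y : omega (rho g x) (rho g y) = omega x y.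
Proof. by have [_ _ _ ->] := rho_sp. Qed.

Lemma reflectionJ r h : (r ^ h^-1 \in sp_reflections rho)%g = (r \in sp_reflections rho).
Proof. by rewrite !inE (dim_reflectionJ rho1E rhoME). Qed.

Lemma bracket1 x y : br 1%g x y = omega x y.
Proof.
rewrite /sra_bracket eqxx mulr1n.
suff -> : 1%g \in sp_reflections rho = false by rewrite mulr0n addr0.
have [_ rho1 _ _] := rho_sp.
by rewrite inE rho1 subrr lim0g dimv0.
Qed.

Lemma bracketL r a x y z : br r (a *: x + y) z = a * br r x z + br r y z.
Proof.
rewrite /sra_bracket omegaL /omega_refl /= linearP omegaL.
by case: (r == 1%g); case: (r \in _); rewrite ?mulr1n ?mulr0n; ring.
Qed.

Lemma bracketC r x y : br r x y = - br r y x.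
Proof.
rewrite /sra_bracket (omegaC x) /omega_refl /= (omegaC (daddv_pi _ _ x)).
by case: (r == 1%g); case: (r \in _); rewrite ?mulr1n ?mulr0n; ring.
Qed.

Lemma bracket_conj r h x y : br (r ^ h^-1)%g (rho h x) (rho h y) = br r x y.
Proof.
rewrite /sra_bracket rho_omega reflectionJ conjg_eq1; congr (_ + _).
case: (boolP (r \in _)) => [rr|_]; last by rewrite !mulr0n.
rewrite etaJ //; congr (_ * _ *+ _).
exact: (reflection_formJ charK rho1E rhoME rho_omega).
Qed.

Lemma bracket_jacobi r x y z :
  br r x y *: (rho r z - z) + br r y z *: (rho r x - x)
  + br r z x *: (rho r y - y) = 0.
Proof.
have [->|r1] := eqVneq r 1%g; first by rewrite !rho1E !subrr !scaler0 !addr0.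
rewrite /sra_bracket (negPf r1) !mulr0n !add0r.
case: (boolP (r \in _)) => [|_]; last by rewrite !mulr0n !scale0r !addr0.
rewrite inE !mulr1n => /eqP dim_r.
have := reflection_jacobi charK omegaL omegaC rho1E rhoME x y z dim_r.
move/(congr1 (fun a : V => eta r *: a)).
by rewrite !scalerDr scaler0 !scalerA.
Qed.

Lemma bracket_fixed r x y : r != 1%g -> br r x y != 0 ->
  r \in sp_reflections rho /\ rho r x != x.
Proof.
rewrite /sra_bracket => /negPf->; rewrite mulr0n add0r.
case: (boolP (r \in _)) => [rr|_]; last by rewrite mulr0n eqxx.
rewrite mulr1n mulf_eq0 negb_or => /andP[_ nz]; split=> //.
apply: contra_neq nz => rx.
exact: (reflection_form0 charK omegaL rho1E rhoME).
Qed.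

Definition twisted_trace (kappa : K) (t : A -> K^o) : Prop :=
  [/\ linear t, forall x a, t (vec x * a) = kappa * t (a * vec x)
    & forall h a, t (grp h * a) = t (a * grp h)].

Lemma sra_word_functional (t : A -> K^o) : linear t ->
  functional act br (fun g s => t (wd s g)).
Proof.
move=> tL; have t0 : t 0 = 0.
  by have := tL (-1) 0 0; rewrite scaler0 addr0 scaleN1r addNr.
apply: (@word_functional _ _ _ _ _ _ (fun c (a : A) => c *: a)).
- by move=> c a a'; apply: pres_scaleAl.
- by move=> c a a'; apply: pres_scaleAr.
- by move=> a x y; apply: sra_vecL.
- exact: sra_grpM.
- exact: sra_cross.
- exact: sra_comm.
- by move=> a a'; have := tL 1 a a'; rewrite !scale1r.
- by move=> c a; have := tL c a 0; rewrite t0 !addr0.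
Qed.

Lemma kdim_decr kappa g r x y : kappa * kappa = 1 -> r != 1%g ->
  kappa *: rho g x = x -> br r x y != 0 ->
  (kdim rho kappa (r * g)%g < kdim rho kappa g)%N.
Proof.
move=> kappa2 r1 gx bn0; have [rr rx] := bracket_fixed r1 bn0.
move: rr; rewrite inE => /eqP dim_r.
exact: (reflection_kdim charK omegaL omegaC omega_nondeg rho1E rhoME rho_omega
  kappa2 dim_r gx rx).
Qed.

Lemma twisted_word_vanishes q kappa (t : A -> K^o) : kappa * kappa = 1 ->
  linear t ->
  (forall x s g, odd (size s) = ~~ q ->
     t (vec x * wd s g) = kappa * t (wd s g * vec x)) ->
  (forall g, q = false -> kdim rho kappa g = 0%N -> t (grp g) = 0) ->
  forall s g, odd (size s) = q -> t (wd s g) = 0.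
Proof.
move=> kappa2 tL tv tg s g.
have [r1 rM rB] := And3 rho1E rhoME rho_omega; have [oL oC] := conj omegaL omegaC.
have [e [f [fe ef]]] := dual_basis oL oC omega_nondeg.
have traceE := fixproj_trace charK omegaL omegaC rho1E rhoME rho_omega kappa2.
apply: (twisted_trace_unique (b := br) (kappa := kappa) (e := e) (f := f)
  (p := fixproj rho kappa) (theta := fixhom rho kappa) (d := kdim rho kappa)
  charK rho1E _ _ _ _ _ _ _ _ (sra_word_functional tL)).
- by move=> h a x y; apply: fixprojL.
- by move=> h x; apply: kact_fixproj.
- by move=> h x; apply: fixproj_id.
- by move=> h x; apply: kact_fixhom.
- by move=> h r x y; apply: kdim_decr.
- by move=> h x y; rewrite !bracket1; apply: fixproj_adj.
- by move=> x; under eq_bigr => j _ do rewrite bracket1; apply: fe.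
- by move=> h; under eq_bigr => j _ do rewrite bracket1; apply: traceE.
- move=> x h s' odd_s; rewrite /twist word_cons.
  rewrite -(word_vec (@sra_cross _ _ omega _ rho eta)).
  by apply/eqP; rewrite subr_eq0; apply/eqP/tv.
- by move=> h q0 dh; rewrite word_nil tg.
Qed.

Lemma twisted_trace_unique0 kappa (t : A -> K^o) : kappa * kappa = 1 ->
  twisted_trace kappa t ->
  (forall g, kdim rho kappa g = 0%N -> t (grp g) = 0) -> forall a, t a = 0.
Proof.
move=> kappa2 [tL tv _] tg; apply: (sra_word_span tL) => s g.
by apply: (twisted_word_vanishes (q := odd (size s)) kappa2 tL) => // h _; apply: tg.
Qed.

Lemma twisted_trace_extension kappa (c : G -> K) : kappa * kappa = 1 ->
  (forall g h, c (g ^ h)%g = c g) ->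
  exists t : A -> K^o, twisted_trace kappa t /\
    forall g, kdim rho kappa g = 0%N -> t (grp g) = c g.
Proof.
move=> kappa2 cJ.
have [r1 rM rB] := And3 rho1E rhoME rho_omega; have [oL oC] := conj omegaL omegaC.
have [e [f [fe ef]]] := dual_basis oL oC omega_nondeg.
have traceE := fixproj_trace charK omegaL omegaC rho1E rhoME rho_omega kappa2.
have [T [FT iT T0 Tc]] : exists T, [/\ functional act br T,
    invariant_functional act T, forall x g s, twist act kappa x T g s = 0
    & forall g, kdim rho kappa g = 0%N -> T g [::] = c g].
  apply: (twisted_trace_exists (e := e) (f := f)
    (p := fixproj rho kappa) (theta := fixhom rho kappa)
    charK _ r1 rM _ _ _ _ kappa2 _ _ _ _ _ _ _ _ _ _ _ _ _ _ _ cJ).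
  - by move=> h a x y; rewrite linearP.
  - exact: bracketL.
  - exact: bracketC.
  - exact: bracket_conj.
  - exact: bracket_jacobi.
  - by move=> h a x y; apply: fixprojL.
  - by move=> h a x y; apply: fixhomL.
  - by move=> h x; apply: kact_fixproj.
  - by move=> h x; apply: fixproj_id.
  - by move=> h x; apply: fixproj_im.
  - by move=> h x; apply: kact_fixhom.
  - by move=> h x; apply: fixhom_im.
  - by move=> h k x; apply: fixprojJ.
  - by move=> h k; apply: kdimJ.
  - by move=> h r x y; apply: kdim_decr.
  - by move=> h x y; rewrite !bracket1; apply: fixproj_adj.
  - by move=> h x; apply: kdim_eq0.
  - by move=> x; under eq_bigr => j _ do rewrite bracket1; apply: fe.
  - by move=> x; under eq_bigr => j _ do rewrite bracket1; apply: ef.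
  - by move=> h; under eq_bigr => j _ do rewrite bracket1; apply: traceE.
have [t tE] := sra_functional r1 rM bracket_conj FT.
have tL : linear (t : A -> K^o) by move=> a x y; rewrite linearP.
have tD (a a' : A) : t (a + a') = t a + t a' by exact: linearD.
have tZ k (a : A) : t (k *: a) = k * t a by exact: linearZ.
have comL (m : A) k (c' : K) (a a' : A) := @twisted_commutator_linear K A (fun c (a : A) => c *: a)
  (@pres_scaleAl _ _ _) (@pres_scaleAr _ _ _) t m k c' a a' tD tZ.
exists t; split; last by move=> g dg; rewrite -[grp g](@word_nil K V G _ vec) tE Tc.
split=> [|x a|h a]; first exact: tL.
  apply/eqP; rewrite -subr_eq0; apply/eqP.
  apply: (@sra_word_span _ _ _ _ _ _
      (fun a => t (vec x * a) - kappa * t (a * vec x))) => [k a1 a2|s g].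
    exact: comL.
  have E : t (wd (x :: s) g) - kappa * t (wd (rcons s (rho g x)) g) = 0.
    exact: etrans (congr2 (fun c1 c2 => c1 - kappa * c2) (tE _ _) (tE _ _)) (T0 x g s).
  exact: (etrans (congr2 (fun a1 a2 => t a1 - kappa * t a2)
    (esym (word_cons vec grp x s g)) (word_vec (@sra_cross _ _ omega _ rho eta) s g x)) E).
rewrite -[RHS]mul1r; apply/eqP; rewrite -subr_eq0; apply/eqP.
apply: (@sra_word_span _ _ _ _ _ _
    (fun a => t (grp h * a) - 1 * t (a * grp h))) => [k a1 a2|s g].
  exact: comL.
have E : t (wd (map (rho h) s) (h * g)%g) - 1 * t (wd s (g * h)%g) = 0.
  apply: etrans (congr2 (fun c1 c2 => c1 - 1 * c2) (tE _ _) (tE _ _)) _.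
  by rewrite -(iT h (g * h)%g) mul1r conjgE invgK !mulgA mulgK subrr.
exact: (etrans (congr2 (fun a1 a2 => t a1 - 1 * t a2)
  (grp_word (@sra_grpM _ _ omega _ rho eta) (@sra_cross _ _ omega _ rho eta) h s g)
  (word_grp vec (@sra_grpM _ _ omega _ rho eta) s g h)) E).
Qed.

Lemma linear_KD (t : A -> K^o) : linear t -> forall a a', t (a + a') = t a + t a'.
Proof. by move=> tL a a'; have := tL 1 a a'; rewrite !scale1r. Qed.

Lemma linear_KZ (t : A -> K^o) : linear t -> forall c a, t (c *: a) = c * t a.
Proof.
move=> tL c a; have t0 : t 0 = 0.
  by have := tL (-1) 0 0; rewrite scaler0 addr0 scaleN1r addNr.
by have := tL c a 0; rewrite t0 !addr0.
Qed.

Lemma commutator_span (t : A -> K^o) (m : A) (k : K) : linear t ->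
  (forall s g, t (m * wd s g) = k * t (wd s g * m)) ->
  forall a, t (m * a) = k * t (a * m).
Proof.
move=> tL tw a; apply/eqP; rewrite -subr_eq0; apply/eqP.
apply: (@sra_word_span _ _ _ _ _ _
    (fun a => t (m * a) - k * t (a * m))) => [c a1 a2|s g].
  exact: (@twisted_commutator_linear K A (fun c (a : A) => c *: a)
    (@pres_scaleAl _ _ _) (@pres_scaleAr _ _ _) t m k c a1 a2
    (linear_KD tL) (linear_KZ tL)).
by apply/eqP; rewrite subr_eq0; apply/eqP/tw.
Qed.

Lemma is_traceP (t : A -> K^o) :
  is_trace omega rho eta t <-> twisted_trace 1 t.
Proof.
split=> [[tL tr]|[tL tv tg]].
  split=> [|x a|h a]; [exact: tL| |exact: tr].
  by apply: etrans (esym (mul1r _)); apply: tr.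
split=> [|f g]; first exact: tL.
rewrite -[RHS]mul1r; apply: (commutator_span tL) => s h.
have E := signed_comm_word (k := 1) tv tg s h f.
by apply: etrans (esym (mul1r _)); apply: esym; apply: etrans E _;
  rewrite expr1n; apply: mul1r.
Qed.

Lemma homog_word s g : sra_homog (odd (size s)) (wd s g).
Proof.
elim: s => [|x s IH].
  by rewrite word_nil; apply: SraHomogGrp.
by rewrite word_cons; apply: (SraHomogM (SraHomogVec _ _ _ x) IH).
Qed.

Lemma twisted_homog (t : A -> K^o) p f : twisted_trace (-1) t ->
  sra_homog p f -> forall m, t (f * m) = (-1) ^+ p * t (m * f).
Proof.
move=> [tL tv tg]; have tD := linear_KD tL; have tZ := linear_KZ tL.
elim=> {p f} [x|g|p|p f f' _ IHf _ IHf'|p c f _ IHf|p q f f' _ IHf _ IHf'] m.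
- exact: tv.
- by rewrite mul1r; apply: tg.
- exact: signed_comm0.
- exact: (signed_commD tD IHf IHf').
- exact: (signed_commZ (@pres_scaleAl _ _ _) (@pres_scaleAr _ _ _) tZ c IHf m).
- exact: etrans (signed_commM IHf IHf' m)
    (congr1 (fun k => k * _) (esym (signr_addb _ p q))).
Qed.

Lemma is_supertraceP (t : A -> K^o) :
  is_supertrace omega rho eta t <-> twisted_trace (-1) t.
Proof.
split=> [[tL tr]|tt]; last first.
  have [tL _ _] := tt; split=> [|p q f g hf hg]; first exact: tL.
  have Ef := twisted_homog tt hf g; have Eg := twisted_homog tt hg f.
  case: p hf Ef => hf Ef; last exact: Ef.
  (* For odd f and even g the required sign is +, which comes from moving the even factor. *)
  case: q hg Eg => hg Eg; first exact: Ef.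
  exact: etrans (esym (mul1r _)) (etrans (esym Eg) (esym (mul1r _))).
(* At even words w a supertrace satisfies t (xw) = t (wx), the equation for kappa = 1. This
   determines odd words, among which there are no free parameters of degree 0. *)
have odd0 s g : odd (size s) -> t (wd s g) = 0.
  move=> odd_s; refine (@twisted_word_vanishes true 1 t (mulr1 1) tL _ _ s g odd_s).
    move=> x s' g' ev; have := tr _ _ _ _ (SraHomogVec _ _ _ x) (homog_word s' g').
    by rewrite ev => E; exact: E.
  by [].
split=> [|x|h a]; first exact: tL.
  apply: (commutator_span tL) => s g.
  have := tr _ _ _ _ (SraHomogVec _ _ _ x) (homog_word s g).
  case odd_s : (odd (size s)) => E; first exact: E.
  have E1 : t (vec x * wd s g) = 0.
    apply: etrans (congr1 t (esym (word_cons vec grp x s g))) _.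
    by apply: odd0; rewrite /= odd_s.
  have E2 : t (wd s g * vec x) = 0.
    apply: etrans (congr1 t (word_vec (@sra_cross _ _ omega _ rho eta) s g x)) _.
    by apply: odd0; rewrite size_rcons /= odd_s.
  apply: etrans E1 _; apply: esym.
  exact: etrans (congr1 (fun c => -1 * c) E2) (mulr0 _).
rewrite -[RHS]mul1r; apply: (commutator_span tL) => s g.
exact: (tr _ _ _ _ (SraHomogGrp _ _ _ h) (homog_word s g)).
Qed.

Lemma twisted_trace_combination kappa (d : nat) (c : 'I_d -> K)
    (b : 'I_d -> A -> K^o) : (forall i, twisted_trace kappa (b i)) ->
  twisted_trace kappa (fun a => \sum_i c i * b i a).
Proof.
move=> tb; split=> [k a a'|x a|h a].
- rewrite scaler_sumr -big_split; apply: eq_bigr => i _ /=.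
  have [bL _ _] := tb i; rewrite bL mulrDr; congr (_ + _); exact: mulrCA.
- rewrite mulr_sumr; apply: eq_bigr => i _; have [_ bv _] := tb i.
  exact: etrans (congr1 (fun q : K => c i * q) (bv x a)) (mulrCA _ _ _).
- apply: eq_bigr => i _; have [_ _ bg] := tb i.
  apply: (congr1 (fun q : K => c i * q)); exact: bg.
Qed.

Lemma twisted_trace_sub kappa (t t' : A -> K^o) :
  twisted_trace kappa t -> twisted_trace kappa t' ->
  twisted_trace kappa (fun a => t a - t' a).
Proof.
move=> [tL tv tg] [tL' tv' tg'].
have sub_eq (p q p' q' : K^o) : p = q -> p' = q' -> p - p' = q - q'.
  by move=> -> ->.
split=> [k a a'|x a|h a]; cbv beta.
- rewrite tL tL' scalerBr; ring.
- apply: etrans _ (esym (mulrBr _ _ _)).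
  by apply: sub_eq; [exact: tv|exact: tv'].
- by apply: sub_eq; [exact: tg|exact: tg'].
Qed.

Lemma leigenvalueE g kappa : kappa * kappa = 1 ->
  ~~ passmx.leigenvalue (rho g) kappa = (kdim rho kappa g == 0%N).
Proof.
move=> kappa2; rewrite /passmx.leigenvalue negbK /kdim dimv_eq0.
suff -> : passmx.leigenspace (rho g) kappa = kfix rho kappa g by [].
apply/vspaceP => x; rewrite /passmx.leigenspace !memv_ker.
rewrite !add_lfunE !opp_lfunE !scale_lfunE id_lfunE !subr_eq0.
apply/eqP/eqP => [->|E]; first by rewrite scalerA kappa2 scale1r.
by rewrite -[in RHS]E scalerA kappa2 scale1r.
Qed.

(** The basis extends the indicators of the classes in [D], so the coordinates of t are its values
    at representatives; uniqueness removes the remaining difference. *)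
Lemma twisted_trace_dim kappa : kappa * kappa = 1 ->
  has_dim (twisted_trace kappa) #|classes_without_eigenvalue rho kappa|.
Proof.
move=> kappa2; set D := classes_without_eigenvalue rho kappa.
have memD g : kdim rho kappa g = 0%N -> (g ^: [set: G])%g \in D.
  move=> dg; rewrite inE mem_classes ?inE //; apply/forall_inP => _ /imsetP[h _ ->].
  by rewrite leigenvalueE // -(invgK h) (kdimJ rho1E rhoME) dg.
have DP (i : 'I_#|D|) : exists2 g, kdim rho kappa g = 0%N & enum_val i = (g ^: [set: G])%g.
  have := enum_valP i; rewrite inE => /andP[/imsetP[g _ iE]].
  rewrite iE => /forall_inP/(_ _ (class_refl _ _)).
  by rewrite leigenvalueE // => /eqP dg; exists g.
pose ind (i : 'I_#|D|) (g : G) : K := (g \in enum_val i)%:R.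
have indJ i g h : ind i (g ^ h)%g = ind i g.
  have [k _ ik] := DP i; rewrite /ind ik; congr (nat_of_bool _)%:R.
  by rewrite memJ_norm // (subsetP (class_norm _ _)) ?inE.
have [b bP] := choice (fun i => twisted_trace_extension kappa2 (indJ i)).
have indE i j g : enum_val j = (g ^: [set: G])%g -> ind i g = (i == j)%:R.
  move=> jg; rewrite /ind; congr (nat_of_bool _)%:R.
  apply/idP/eqP => [gi|->]; last by rewrite jg class_refl.
  have [k _ ik] := DP i; apply: enum_val_inj; rewrite jg ik.
  by apply/esym/class_eqP; rewrite -ik.
have evalE (c : 'I_#|D| -> K) a : (\sum_i c i *: b i) a = \sum_i c i * b i a.
  by elim/big_rec2: _ => [//|i q q' _ <-].
have bE c j g : enum_val j = (g ^: [set: G])%g -> kdim rho kappa g = 0%N ->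
    \sum_i c i * b i (grp g) = c j.
  move=> jg dg; rewrite (bigD1 j) //= (bP j).2 // (indE _ _ _ jg) eqxx mulr1.
  rewrite big1 ?addr0 // => i ij.
  by rewrite (bP i).2 // (indE _ _ _ jg) (negPf ij) mulr0.
exists b; split=> [c c0 j|t].
  by have [g dg jg] := DP j; rewrite -(bE c j g jg dg) -evalE c0.
split=> [tt|[c ->]]; last first.
  rewrite (_ : \sum_i c i *: b i = fun a => \sum_i c i * b i a).
    by apply: twisted_trace_combination => i; case: (bP i).
  by apply/funext => a; apply: evalE.
exists (fun i => t (grp (repr (enum_val i)))).
apply/funext => a; rewrite evalE; apply/eqP; rewrite -subr_eq0; apply/eqP; move: a.
apply: (twisted_trace_unique0 kappa2).
  apply: twisted_trace_sub; first exact: tt.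
  by apply: twisted_trace_combination => i; case: (bP i).
move=> g dg; pose j := enum_rank_in (memD g dg) (g ^: [set: G])%g.
have jg : enum_val j = (g ^: [set: G])%g by rewrite enum_rankK_in // memD.
rewrite (bE _ j g jg dg) jg; apply/eqP; rewrite subr_eq0; apply/eqP.
(* The chosen representative is only conjugate to g; commutation with group elements equates the two
   values of t. *)
have /imsetP[h _ ->] := mem_repr _ (class_refl [set: G] g).
have [_ _ tg] := tt.
have gE : grp g = grp h * grp (h^-1 * g)%g by rewrite -sra_grpM mulKVg.
have ghE : grp (h^-1 * g)%g * grp h = grp (g ^ h)%g.
  by rewrite -sra_grpM conjgE mulgA.
exact: etrans (congr1 t gE) (etrans (tg h _) (congr1 t ghE)).
Qed.

End SraTraces.

Lemma eq_has_dim (K : fieldType) (E : lmodType K) (W W' : E -> Prop) d :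
  (forall e, W e <-> W' e) -> has_dim W d -> has_dim W' d.
Proof.
move=> WW' [b [b_free b_span]]; exists b; split=> // e.
by apply: iff_trans (b_span e); apply: iff_sym.
Qed.

Theorem theorem5p2 (R : realType) (N : nat)
    (omega : {skew_symmetric 'rV[R[i]]_(2 * N)})
    (homega : nondegenerate omega)
    (G : finGroupType) (rho : G -> 'End('rV[R[i]]_(2 * N)))
    (hG : sp_reflection_group omega rho)
    (eta : G -> R[i])
    (heta : forall r g : G, r \in sp_reflections rho ->
              eta (r ^ g)%g = eta r) :
  has_dim (is_trace omega rho eta)
    #|classes_without_eigenvalue rho 1| /\
  has_dim (is_supertrace omega rho eta)
    #|classes_without_eigenvalue rho (-1)|.
Proof.
have [rho_sp _] := hG.
have charK n : n.+1%:R != 0 :> R[i] by rewrite pnatr_eq0.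
split; apply: eq_has_dim.
- by move=> t; apply: iff_sym; apply: is_traceP.
- by apply: twisted_trace_dim => //; rewrite mulr1.
- by move=> t; apply: iff_sym; apply: is_supertraceP.
- by apply: twisted_trace_dim => //; rewrite mulrNN mulr1.
Qed.
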